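(* Let $p\ge 2$ be an integer, let $a>0$ be fixed, and let $g$ be a real-valued Borel measurable function on $[0,a]$ (its value at $0$ being immaterial) such that (i) $w^{(p-1)/2}|g(w)|$ is bounded on $[0,a]$; (ii) there exists a nonnegative real $b$ such that $\displaystyle\lim_{w\nearrow a}\frac{g(w)}{(a-w)^b}=1$. For $\theta\in\mathbb{R}^p$ let $X\sim\mathcal{N}_p(\theta,I_p)$, put $\nu=\|\theta\|^2$, and define $$G(\nu;a)=\mathrm{E}\left[g(\|X\|^2)\,I_{[0,a]}(\|X\|^2)\right].$$ Let $$c(a,b,p)=\frac{a^{(p-1)/4+b/2}\,2^b\,\Gamma(b+1)}{\sqrt{2\pi}\,\exp(a/2)}.$$ Then $$\lim_{\nu\to\infty}\frac{\nu^{(p+1)/4+b/2}\,e^{\nu/2}}{e^{\sqrt{\nu}\sqrt{a}}}\,G(\nu;a)=c(a,b,p).$$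
   Context: $\|\cdot\|$ is the Euclidean norm, $I_p$ is the $p\times p$ identity matrix, $I_{[0,a]}$ is the indicator function of $[0,a]$, and $\Gamma$ is the Gamma function. The expectation $G(\nu;a)$ depends on $\theta$ only through $\nu=\|\theta\|^2$, since $\|X\|^2$ has a noncentral chi-square distribution with $p$ degrees of freedom and noncentrality parameter $\nu$. *)

(* Defs.v *)
From HB Require Import structures.
From mathcomp Require Import all_boot all_order all_algebra.
From mathcomp Require Import all_classical all_reals all_analysis.
From mathcomp Require Import measurable_realfun.

Set Implicit Arguments.
Unset Strict Implicit.
Unset Printing Implicit Defensive.

Import Order.TTheory GRing.Theory Num.Theory.
Import numFieldNormedType.Exports.

Local Open Scope classical_set_scope.
Local Open Scope ring_scope.

Definition Gamma (R : realType) (x : R) : R :=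
  (\int[lebesgue_measure]_(t in `]0, +oo[) (t `^ (x - 1) * expR (- t)))%R.

(* R^n with its product (= Borel) sigma-algebra; [measurableTypeR R] is the
   copy of R that carries [lebesgue_measure]. *)
Notation rvec R n := (n.-tuple (measurableTypeR R)).

Definition enorm (R : realType) (n : nat) (x : rvec R n) : R :=
  Num.sqrt (\sum_(i < n) (tnth x i : R) ^+ 2).

Definition rvec_sub (R : realType) (n : nat) (x y : rvec R n) : rvec R n :=
  [tuple (tnth x i : R) - tnth y i | i < n].

Section cons_measure.
Local Open Scope ereal_scope.
Context (R : realType) (n : nat).
Variable m : {sigma_finite_measure set (rvec R n) -> \bar R}.

Definition rvec_cons (u : measurableTypeR R * rvec R n) : rvec R n.+1 :=
  [tuple of u.1 :: u.2].

Lemma measurable_rvec_cons : measurable_fun setT rvec_cons.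
Proof. exact: (measurable_cons measurable_fst measurable_snd). Qed.

Definition cons_measure : set (rvec R n.+1) -> \bar R :=
  pushforward (lebesgue_measure \x m) rvec_cons.

Let cons_measure0 : cons_measure set0 = 0.
Proof. by rewrite /cons_measure /pushforward preimage_set0 measure0. Qed.

Let cons_measure_ge0 A : 0 <= cons_measure A.
Proof. by rewrite /cons_measure /pushforward; exact: measure_ge0. Qed.

Let cons_measure_sigma_additive : semi_sigma_additive cons_measure.
Proof.
exact: (@measure_semi_sigma_additive _ _ _
  (measure_function_pushforward__canonical__measure_function_Measure
    (lebesgue_measure \x m) measurable_rvec_cons)).
Qed.

HB.instance Definition _ := isMeasure.Build _ _ _ cons_measure
  cons_measure0 cons_measure_ge0 cons_measure_sigma_additive.

Let cons_measure_sigma_finite : sigma_finite setT cons_measure.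
Proof.
have [F FT Foo] := sigma_finiteT (@lebesgue_measure R).
have [G GT Goo] := sigma_finiteT m.
pose split (t : rvec R n.+1) : measurableTypeR R * rvec R n :=
  (thead t, [tuple of behead t]).
have splitK u : split (rvec_cons u) = u.
  by case: u => x t; congr pair; apply/val_inj.
have msplit : measurable_fun setT split.
  by apply/measurable_fun_pair; [exact: measurable_tnth|exact: measurable_behead].
pose H (i : nat) : set (measurableTypeR R * rvec R n) :=
  let: (j, k) := odflt (0, 0)%N (unpickle i) in F j `*` G k.
have mH i : measurable (H i).
  rewrite /H; case: (odflt _ _) => j k.
  by apply: measurableX; [exact: (Foo j).1|exact: (Goo k).1].
exists (fun i => split @^-1` H i).
  rewrite -preimage_bigcup (_ : \bigcup_i H i = setT) ?preimage_setT//.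
  apply/seteqP; split => // -[x y] _.
  have [j _ Fjx] : (\bigcup_i F i) x by rewrite -FT.
  have [k _ Gky] : (\bigcup_i G i) y by rewrite -GT.
  by exists (pickle (j, k)) => //; rewrite /H pickleK.
move=> i; split; first by rewrite -[X in measurable X]setTI; exact: msplit.
rewrite /cons_measure /pushforward (_ : _ @^-1` _ = H i); last first.
  by apply/seteqP; split => u /=; rewrite splitK.
rewrite /H; case: (odflt _ _) => j k.
have [[mF Fj] [mG Gk]] := (Foo j, Goo k).
by rewrite product_measure1E// lte_mul_pinfty// ge0_fin_numE.
Qed.

HB.instance Definition _ := Measure_isSigmaFinite.Build _ _ _ cons_measure
  cons_measure_sigma_finite.

End cons_measure.

(* Lebesgue measure on R^n, as an iterated product. *)
Fixpoint lebesgue_rvec (R : realType) (n : nat) :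
    {sigma_finite_measure set (rvec R n) -> \bar R} :=
  match n with
  | 0 => \d_[tuple]
  | n'.+1 => cons_measure (lebesgue_rvec R n')
  end.

(* density of N_n(theta, I_n) *)
Definition mvnormal_pdf (R : realType) (n : nat) (theta x : rvec R n) : R :=
  (2 * pi) `^ (- (n%:R / 2)) * expR (- (enorm (rvec_sub x theta) ^+ 2 / 2)).

Definition mvnormal_prob (R : realType) (n : nat) (theta : rvec R n)
    (A : set (rvec R n)) : \bar R :=
  (\int[lebesgue_rvec R n]_(x in A) (mvnormal_pdf theta x)%:E)%E.

Lemma enorm_sq (R : realType) n (x : rvec R n) :
  enorm x ^+ 2 = \sum_(i < n) (tnth x i : R) ^+ 2.
Proof. by rewrite sqr_sqrtr// sumr_ge0// => i _; exact: sqr_ge0. Qed.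

Lemma mvnormal_pdfE (R : realType) n (theta x : rvec R n) :
  mvnormal_pdf theta x = \prod_(i < n) normal_pdf (tnth theta i) 1 (tnth x i).
Proof.
rewrite /mvnormal_pdf enorm_sq.
under [RHS]eq_bigr do rewrite normal_pdfE ?oner_eq0//.
rewrite big_split/= prodr_const card_ord; congr (_ * _).
  rewrite /normal_peak expr1n mul1r -(mulr_natl pi).
  have pi2 : 0 <= 2 * pi :> R by rewrite mulr_ge0// pi_ge0.
  rewrite exprVn -powR12_sqrt// -powR_mulrn ?powR_ge0// -powRrM -powRN.
  by congr (_ `^ _); rewrite mulrC.
rewrite /normal_fun -expR_sum; congr expR.
rewrite mulr_suml -sumrN; apply: eq_bigr => i _.
by rewrite tnth_mktuple expr1n mulNr.
Qed.

Lemma mvnormal_pdf_ge0 (R : realType) n (theta x : rvec R n) :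
  0 <= mvnormal_pdf theta x.
Proof.
by rewrite mvnormal_pdfE prodr_ge0// => i _; exact: normal_pdf_ge0.
Qed.

Lemma measurable_mvnormal_pdf (R : realType) n (theta : rvec R n) :
  measurable_fun setT (mvnormal_pdf theta : rvec R n -> R).
Proof.
rewrite (_ : mvnormal_pdf theta = fun x => \prod_(i <- index_enum 'I_n) normal_pdf (tnth theta i) 1 (tnth x i)).
  apply: measurable_prod => i _.
  apply: (@measurableT_comp _ _ _ _ _ _ (normal_pdf (tnth theta i) 1)).
    exact: measurable_normal_pdf.
  exact: measurable_tnth.
by apply/funext => x; rewrite mvnormal_pdfE.
Qed.

Lemma measurable_EFin_mvnormal_pdf (R : realType) n (theta : rvec R n) :
  measurable_fun setT (fun x : rvec R n => (mvnormal_pdf theta x)%:E).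
Proof. by apply: measurableT_comp => //; exact: measurable_mvnormal_pdf. Qed.

Lemma mvnormal_prob_setT (R : realType) n (theta : rvec R n) : mvnormal_prob theta setT = 1%E.
Proof.
elim: n theta => [|n IH] theta.
  rewrite /mvnormal_prob integral_dirac//; last exact: measurable_EFin_mvnormal_pdf.
  by rewrite diracT mul1e mvnormal_pdfE big_ord0.
rewrite /mvnormal_prob.
have := @ge0_integral_pushforward _ _ _ _ R _ (@measurable_rvec_cons R n) (lebesgue_measure \x lebesgue_rvec R n)%E setT (fun x => (mvnormal_pdf theta x)%:E) measurableT.
rewrite preimage_setT => h.
transitivity (\int[pushforward (lebesgue_measure \x lebesgue_rvec R n)%E (@rvec_cons R n)]_x (mvnormal_pdf theta x)%:E)%E; first by [].
rewrite h; last 2 first.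
- exact: measurable_EFin_mvnormal_pdf.
- by move=> x _; rewrite lee_fin mvnormal_pdf_ge0.
have mc : measurable_fun setT (mvnormal_pdf theta \o @rvec_cons R n).
  apply: measurableT_comp; [exact: measurable_mvnormal_pdf|exact: measurable_rvec_cons].
rewrite fubini_tonelli1//=; last 2 first.
- by apply: (measurableT_comp (@measurable_EFin_mvnormal_pdf R n.+1 theta)); exact: measurable_rvec_cons.
- by move=> x; rewrite lee_fin mvnormal_pdf_ge0.
rewrite /fubini_F/=.
rewrite -(integral_normal_pdf (tnth theta ord0 : R) 1).
apply: eq_integral => x _.
transitivity (\int[lebesgue_rvec R n]_y ((normal_pdf (tnth theta ord0) 1 x)%:E * (mvnormal_pdf ([tuple of behead theta] : rvec R n) y)%:E))%E.
  apply: eq_integral => y _.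
  rewrite -EFinM !mvnormal_pdfE big_ord_recl /=; congr (_ * _)%:E.
  apply: eq_bigr => i _; rewrite [in LHS](tuple_eta theta) !tnthS.
  by rewrite /rvec_cons; congr normal_pdf; rewrite [LHS]tnthS.
rewrite ge0_integralZl//=.
- have := IH [tuple of behead theta]; rewrite /mvnormal_prob => ->.
  by rewrite mule1.
- exact: measurable_EFin_mvnormal_pdf.
- by move=> y _; rewrite lee_fin mvnormal_pdf_ge0.
- by rewrite lee_fin normal_pdf_ge0.
Qed.

Section mvnormal_probability.
Context (R : realType) (n : nat) (theta : rvec R n).

Let mvnormal0 : mvnormal_prob theta set0 = 0%E.
Proof. by rewrite /mvnormal_prob integral_set0. Qed.

Let mvnormal_ge0 A : (0 <= mvnormal_prob theta A)%E.
Proof. by apply: integral_ge0 => x _; rewrite lee_fin mvnormal_pdf_ge0. Qed.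

Let mvnormal_sigma_additive : semi_sigma_additive (mvnormal_prob theta).
Proof.
move=> A mA tA mUA; rewrite /mvnormal_prob/= ge0_integral_bigcup//=.
- apply: is_cvg_ereal_nneg_natsum_cond => i _ _.
  by apply: integral_ge0 => x _; rewrite lee_fin mvnormal_pdf_ge0.
- exact: measurable_funS (measurable_EFin_mvnormal_pdf theta).
- by move=> x _; rewrite lee_fin mvnormal_pdf_ge0.
Qed.

HB.instance Definition _ := isMeasure.Build _ _ _ (mvnormal_prob theta)
  mvnormal0 mvnormal_ge0 mvnormal_sigma_additive.

HB.instance Definition _ := @Measure_isProbability.Build _ _ R
  (mvnormal_prob theta) (mvnormal_prob_setT theta).

End mvnormal_probability.

Definition is_mvnormal d (T : measurableType d) (R : realType)
    (P : probability T R) (n : nat) (X : {RV P >-> rvec R n})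
    (theta : rvec R n) : Prop :=
  forall A, measurable A -> distribution P X A = mvnormal_prob theta A.

Definition limit_const (R : realType) (a b : R) (p : nat) : R :=
  a `^ ((p%:R - 1) / 4 + b / 2) * 2 `^ b * Gamma (b + 1)
    / (Num.sqrt (2 * pi) * expR (a / 2)).

(* Main.v *)
Require Import Defs.
From mathcomp Require Import all_boot all_order all_algebra.
From mathcomp Require Import all_classical all_reals all_analysis.
From mathcomp Require Import measurable_realfun ring lra.

(** Completing the square and using rotation invariance of Lebesgue measure,
    [exp(nu/2) G(nu)] becomes [int k(x^2 + |y|^2) exp(s x) dx dy] over
    [R x R^(p-1)] with [s = sqrt nu], where [k] is [g] times the radial Gaussian
    weight on the ball of radius [r = sqrt a]. Hypothesis (i) makes [k]
    integrable. For large [s] the mass concentrates near the pole [(r, 0)]: the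
    part [x <= r1 < r] is exponentially negligible, and on the rest the
    substitution [x = r - v/s], [y = eta/sqrt s] turns the distance to the edge
    into [s (a - x^2 - |y|^2) = 2 r v - |eta|^2 - v^2/s]. By hypothesis (ii) the
    rescaled integrand converges to a constant times
    [(2 r v - |eta|^2)_+^b exp(-v)], which also dominates it; dominated
    convergence and a Gaussian times Gamma integral give the limit. *)

Set Implicit Arguments.
Unset Strict Implicit.
Unset Printing Implicit Defensive.

Import Order.TTheory GRing.Theory Num.Theory.
Import numFieldNormedType.Exports.

Local Open Scope classical_set_scope.
Local Open Scope ring_scope.

(** Hypothesis (i) lets [g(|z|^2)] blow up like [|z|^(-(p-1))] at the origin of R^p, one power short
    of the critical rate, so integrability has to be proved; this is done by covering dyadic shells
    with Gaussians instead of using polar coordinates. Lebesgue measure on R^n is an iterated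
    product here, so rotation invariance is assembled from planar rotations, and every change of
    variables from affine substitutions on the line. Only functions of one coordinate and of the
    squared norm of the others ever occur, which keeps this cheap. The two scales of the
    substitution are forced by the geometry. Moving inwards by [v/s] costs the factor [exp(-v)],
    while the sphere leaves its tangent plane quadratically, so transverse displacements count at
    order [1/sqrt s]. The volume element then gives [s^(-1-(p-1)/2)] and the edge factor gives
    [s^(-b)]. Together they account for the power [(p+1)/2 + b] of [s], that is [(p+1)/4 + b/2] of
    [nu]. *)

(** * Affine substitutions on the real line *)

Section affine_substitution.
Context {R : realType}.
Implicit Types (c d : R) (f : R -> \bar R).
Local Notation mu := (@lebesgue_measure R).

Lemma measurable_affine c d :
  measurable_fun setT ((fun x => c * x + d) : measurableTypeR R -> measurableTypeR R).
Proof. by apply: measurable_funD => //; exact: measurable_funM. Qed.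

(** By uniqueness of Lebesgue measure it is enough to compare lengths of half-open intervals. For
    [c < 0] the preimage of []x, y]] is closed at the left end instead, with the same length. *)
Lemma lebesgue_measure_affine c d (A : set (measurableTypeR R)) : c != 0 ->
  measurable A ->
  (mu A = `|c|%:E * mu ((fun x => (c * x + d)%R) @^-1` A))%E.
Proof.
move=> c0 mA.
pose m : {measure set (measurableTypeR R) -> \bar R} :=
  mscale (NngNum (normr_ge0 c))
    (measure_function_pushforward__canonical__measure_function_Measure
      mu (measurable_affine c d)).
rewrite (@lebesgue_measure_unique R m) //= => _ [[x y]] _ <- /=.
rewrite /mscale/= /pushforward.
have [cp|cn|/eqP] := ltgtP c 0; last by rewrite (negbTE c0).
- have -> : (fun x0 => c * x0 + d) @^-1` `]x, y] = `[(y - d) / c, (x - d) / c[%classic.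
    apply/seteqP; split=> u /=; rewrite !in_itv/= ler_ndivrMr// ltr_ndivlMr//; lra.
  rewrite !lebesgue_measure_itv/= !lte_fin ltr_nM2r ?invr_lt0// ltrD2r.
  case: ifP => _; last by rewrite mule0.
  rewrite -!EFinD -EFinM ltr0_norm//; congr EFin; field; exact: ltr0_neq0.
- have -> : (fun x0 => c * x0 + d) @^-1` `]x, y] = `](x - d) / c, (y - d) / c]%classic.
    apply/seteqP; split=> u /=; rewrite !in_itv/= ltr_pdivrMr// ler_pdivlMr//; lra.
  rewrite !lebesgue_measure_itv/= !lte_fin ltr_pM2r ?invr_gt0// ltrD2r.
  case: ifP => _; last by rewrite mule0.
  rewrite -!EFinD -EFinM gtr0_norm//; congr EFin; field; exact: lt0r_neq0.
Qed.

Lemma ge0_integral_affine c d f : c != 0 -> measurable_fun setT f ->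
  (forall x, 0 <= f x)%E ->
  (\int[mu]_x f x = `|c|%:E * \int[mu]_x f (c * x + d)%R)%E.
Proof.
move=> c0 mf f0.
pose push : {measure set (measurableTypeR R) -> \bar R} :=
  measure_function_pushforward__canonical__measure_function_Measure
      mu (measurable_affine c d).
transitivity (\int[mscale (NngNum (normr_ge0 c)) push]_x f x)%E.
  by apply: eq_measure_integral => A mA _; exact: lebesgue_measure_affine.
rewrite ge0_integral_mscale//=; congr (_ * _)%E.
rewrite (ge0_integral_pushforward (measurable_affine c d))//.
Qed.

Lemma ge0_integral_opp f : measurable_fun setT f -> (forall x, 0 <= f x)%E ->
  (\int[mu]_x f x = \int[mu]_x f (- x)%R)%E.
Proof.
move=> mf f0; rewrite (@ge0_integral_affine (-1) 0)// ?oppr_eq0 ?oner_eq0//.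
by rewrite normrN1 mul1e; under eq_integral do rewrite mulN1r addr0.
Qed.

End affine_substitution.

(** * Rotation invariance in the plane *)

Section planar_rotation.
Context {R : realType}.
Local Notation mu := (@lebesgue_measure R).
Local Notation RR := (measurableTypeR R).

Lemma tonelli_swap (f : RR -> RR -> \bar R) :
  measurable_fun setT (fun z : RR * RR => f z.1 z.2) ->
  (forall x y, 0 <= f x y)%E ->
  (\int[mu]_x \int[mu]_y f x y = \int[mu]_y \int[mu]_x f x y)%E.
Proof.
move=> mf f0.
exact: (@fubini_tonelli _ _ _ _ _ mu mu (fun z : RR * RR => f z.1 z.2)).
Qed.

(** The rotation is a composition of two one-variable affine maps: [y] is replaced by
    [(y - s x) / c] for fixed [x], then [x] by [c x + s y] for fixed [y]. Their Jacobians [1/|c|]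
    and [|c|] cancel. The division is the reason for [c != 0]. *)
Lemma ge0_integral_rotation (c s : R) (F : RR * RR -> \bar R) :
  c != 0 -> c ^+ 2 + s ^+ 2 = 1 ->
  measurable_fun setT F -> (forall z, 0 <= F z)%E ->
  (\int[mu]_x \int[mu]_y F (x, y) =
   \int[mu]_x \int[mu]_y F (c * x + s * y, c * y - s * x)%R)%E.
Proof.
move=> c0 cs1 mF F0.
have mvar (f g : RR * RR -> RR) : measurable_fun setT f -> measurable_fun setT g ->
    measurable_fun setT (fun z => F (f z, g z)).
  by move=> mf mg; apply: (measurableT_comp mF); exact/measurable_fun_pair.
have -> : (\int[mu]_x \int[mu]_y F (x, y) =
    \int[mu]_x \int[mu]_y (`|c^-1|%:E * F (x, (y - s * x) / c)%R))%E.
  apply: eq_integral => x _.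
  rewrite (@ge0_integral_affine _ c^-1 (- s * x / c))//; last 2 first.
  - by rewrite invr_eq0.
  - by apply: (measurableT_comp mF); exact/measurable_fun_pair.
  rewrite ge0_integralZl//.
  - congr (_ * _)%E; apply: eq_integral => y _; congr (F (_, _)).
    by rewrite mulrDl mulNr mulrC.
  - apply: (measurableT_comp mF); apply/measurable_fun_pair => //.
    by apply: measurable_funM => //; exact: measurable_funD.
have mF1 : measurable_fun setT
    (fun z : RR * RR => (`|c^-1|%:E * F (z.1, (z.2 - s * z.1) / c)%R)%E).
  apply: measurable_funeM; apply: mvar => //.
  apply: measurable_funM => //; apply: measurable_funB => //.
  exact: measurable_funM.
rewrite [LHS]tonelli_swap; [|exact: mF1|by move=> x y; rewrite mule_ge0].
rewrite [RHS]tonelli_swap; last by move=> x y; exact: F0.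
  2: apply: mvar; [apply: measurable_funD|apply: measurable_funB];
       exact: measurable_funM.
apply: eq_integral => y _.
rewrite (@ge0_integral_affine _ c (s * y))//; last 2 first.
- apply: (measurableT_comp mF1 (pair2_measurable y)).
- by move=> x; rewrite mule_ge0.
under eq_integral => x _.
  have -> : ((y - s * (c * x + s * y)) / c = c * y - s * x)%R.
    rewrite (_ : y - _ = y * (1 - s ^+ 2) - s * c * x); last ring.
    have -> : 1 - s ^+ 2 = c ^+ 2 by rewrite -cs1 addrK.
    by field.
  over.
rewrite ge0_integralZl//; last first.
  apply: (measurableT_comp mF); apply/measurable_fun_pair.
    by apply: measurable_funD => //; exact: measurable_funM.
  by apply: measurable_funB => //; exact: measurable_funM.
by rewrite muleA -EFinM -normrM divff// normr1 mul1e.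
Qed.

(** The rotation with cosine [al / r] and sine [be / r] carries [r x] to [al x + be y] and fixes
    [x^2 + y^2]. When [al = 0] the cosine vanishes, and the quarter turn is replaced by exchanging
    the coordinates, with a reflection if [be < 0]. *)
Lemma ge0_integral_radial_expR2 (H : R -> \bar R) (al be : R) :
  measurable_fun setT H -> (forall t, 0 <= H t)%E ->
  (\int[mu]_x \int[mu]_y (H (x ^+ 2 + y ^+ 2)%R * (expR (al * x + be * y))%:E) =
   \int[mu]_x \int[mu]_y (H (x ^+ 2 + y ^+ 2)%R *
     (expR (Num.sqrt (al ^+ 2 + be ^+ 2) * x))%:E))%E.
Proof.
move=> mH H0.
have mHE (a b : R) : measurable_fun setT (fun z : RR * RR =>
    (H (z.1 ^+ 2 + z.2 ^+ 2)%R * (expR (a * z.1 + b * z.2))%:E)%E).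
  apply: emeasurable_funM.
    apply: (measurableT_comp mH); apply: measurable_funD => //; exact: measurable_funX.
  apply/measurable_EFinP; apply: measurableT_comp => //.
  by apply: measurable_funD => //; exact: measurable_funM.
have HE0 (a b : R) (z : RR * RR) :
    (0 <= H (z.1 ^+ 2 + z.2 ^+ 2)%R * (expR (a * z.1 + b * z.2))%:E)%E.
  by rewrite mule_ge0// lee_fin expR_ge0.
have [al0|al0] := eqVneq al 0.
  subst al; rewrite expr0n/= add0r sqrtr_sqr.
  rewrite [LHS]tonelli_swap; [|exact: mHE|by move=> x y; exact: (HE0 0 be (x, y))].
  have [be0|be0] := leP 0 be.
    apply: eq_integral => y _; apply: eq_integral => x _.
    by rewrite mul0r add0r addrC ger0_norm.
  rewrite [LHS]ge0_integral_opp; last 2 first.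
  - exact: (measurable_fun_fubini_tonelli_G (fun z : RR * RR =>
      (H (z.1 ^+ 2 + z.2 ^+ 2)%R * (expR (0 * z.1 + be * z.2))%:E)%E)).
  - by move=> x; apply: integral_ge0 => y _; exact: (HE0 0 be (_, _)).
  apply: eq_integral => y _; apply: eq_integral => x _.
  by rewrite mul0r add0r addrC sqrrN ltr0_norm// mulrN mulNr.
set r := Num.sqrt _.
have r2 : r ^+ 2 = al ^+ 2 + be ^+ 2 by rewrite sqr_sqrtr// addr_ge0// sqr_ge0.
have r0 : r != 0.
  by rewrite sqrtr_eq0 -ltNge ltr_wpDr ?sqr_ge0// exprn_even_gt0.
have cs1 : (al / r) ^+ 2 + (be / r) ^+ 2 = 1.
  by rewrite !expr_div_n -mulrDl -r2 divff// expf_eq0.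
have c0 : al / r != 0 by rewrite mulf_neq0// invr_eq0.
refine (eq_trans (eq_trans _ (esym (ge0_integral_rotation c0 cs1 (mHE r 0) (HE0 r 0)))) _); last first.
  by apply: eq_integral => x _; apply: eq_integral => y _ /=; rewrite mul0r addr0.
apply: eq_integral => x _; apply: eq_integral => y _ /=.
congr (H _ * (expR _)%:E)%E; last by field.
transitivity (((al / r) ^+ 2 + (be / r) ^+ 2) * (x ^+ 2 + y ^+ 2)); last by ring.
by rewrite cs1 mul1r.
Qed.

End planar_rotation.

(** * Squared norm, dot product and iterated integrals on R^n *)

Section rvec_integration.
Context {R : realType}.
Local Notation mu := (@lebesgue_measure R).
Local Notation RR := (measurableTypeR R).

Definition sqnorm n (x : rvec R n) : R := \sum_(i < n) (tnth x i : R) ^+ 2.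

Definition dotp n (x y : rvec R n) : R := \sum_(i < n) (tnth x i : R) * tnth y i.

Lemma sqnorm_ge0 n (x : rvec R n) : 0 <= sqnorm x.
Proof. by apply: sumr_ge0 => i _; exact: sqr_ge0. Qed.

Lemma sqnorm0 (x : rvec R 0) : sqnorm x = 0.
Proof. by rewrite /sqnorm big_ord0. Qed.

Lemma sqnorm_cons n (x : RR) (y : rvec R n) :
  sqnorm (rvec_cons (x, y)) = x ^+ 2 + sqnorm y.
Proof.
rewrite /sqnorm big_ord_recl; congr (_ + _).
by apply: eq_bigr => i _; rewrite [tnth _ _]tnthS.
Qed.

Lemma dotp_cons n (th : rvec R n.+1) (x : RR) (y : rvec R n) :
  dotp th (rvec_cons (x, y)) = thead th * x + dotp [tuple of behead th] y.
Proof.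
rewrite /dotp big_ord_recl; congr (_ + _).
apply: eq_bigr => i _; rewrite [in LHS](tuple_eta th) tnthS; congr (_ * _).
exact: tnthS.
Qed.

Lemma sqnorm_behead n (th : rvec R n.+1) :
  sqnorm th = thead th ^+ 2 + sqnorm [tuple of behead th].
Proof. by rewrite {1}(tuple_eta th) -sqnorm_cons. Qed.

Lemma measurable_sqnorm n : measurable_fun setT (@sqnorm n : rvec R n -> RR).
Proof.
apply: measurable_sum => i; apply: measurable_funX; exact: measurable_tnth.
Qed.

Lemma measurable_dotp n (th : rvec R n) :
  measurable_fun setT (dotp th : rvec R n -> RR).
Proof.
by apply: measurable_sum => i; apply: measurable_funM => //; exact: measurable_tnth.
Qed.

Lemma ge0_integral_rvecS n (f : rvec R n.+1 -> \bar R) :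
  measurable_fun setT f -> (forall x, 0 <= f x)%E ->
  (\int[lebesgue_rvec R n.+1]_x f x =
   \int[mu \x lebesgue_rvec R n]_z f (rvec_cons z))%E.
Proof.
move=> mf f0.
by have := @ge0_integral_pushforward _ _ _ _ R _ (@measurable_rvec_cons R n)
  (mu \x lebesgue_rvec R n)%E setT f measurableT mf (fun x _ => f0 x).
Qed.

Lemma ge0_integral_rvecS_iter n (f : rvec R n.+1 -> \bar R) :
  measurable_fun setT f -> (forall x, 0 <= f x)%E ->
  (\int[lebesgue_rvec R n.+1]_x f x =
   \int[mu]_x \int[lebesgue_rvec R n]_y f (rvec_cons (x, y)))%E.
Proof.
move=> mf f0; rewrite ge0_integral_rvecS//.
rewrite fubini_tonelli1//.
exact: (measurableT_comp mf (@measurable_rvec_cons R n)).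
Qed.

Lemma ge0_integral_rvec0 (f : rvec R 0 -> \bar R) : measurable_fun setT f ->
  (\int[lebesgue_rvec R 0]_x f x = f [tuple])%E.
Proof. by move=> mf; rewrite integral_dirac// diracT mul1e. Qed.

End rvec_integration.

(** * Rotation invariance in R^n *)

Section radial_integration.
Context {R : realType}.
Local Notation mu := (@lebesgue_measure R).
Local Notation RR := (measurableTypeR R).

Lemma measurable_radial n (H : R -> \bar R) : measurable_fun setT H ->
  measurable_fun setT (fun z : RR * rvec R n => H (z.1 ^+ 2 + sqnorm z.2)).
Proof.
move=> mH; apply: (measurableT_comp mH); apply: measurable_funD.
  exact: measurable_funX.
exact: (measurableT_comp (@measurable_sqnorm R n)).
Qed.

Lemma measurable_radial_expR n (H : R -> \bar R) (s : R) : measurable_fun setT H ->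
  measurable_fun setT (fun z : RR * rvec R n =>
    H (z.1 ^+ 2 + sqnorm z.2)%R * (expR (s * z.1))%:E)%E.
Proof.
move=> mH; apply: emeasurable_funM; first exact: measurable_radial.
by apply/measurable_EFinP; apply: measurableT_comp => //; exact: measurable_funM.
Qed.

Lemma measurable_sqnorm_expR n (H : R -> \bar R) (th : rvec R n) (t : R) :
  measurable_fun setT H ->
  measurable_fun setT (fun x : rvec R n =>
    H (t + sqnorm x)%R * (expR (dotp th x))%:E)%E.
Proof.
move=> mH; apply: emeasurable_funM.
  apply: (measurableT_comp mH); apply: measurable_funD => //.
  exact: measurable_sqnorm.
by apply/measurable_EFinP; apply: measurableT_comp => //; exact: measurable_dotp.
Qed.

Lemma ge0_integral_radial_expR_abs (H : R -> \bar R) (t : R) :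
  measurable_fun setT H -> (forall x, 0 <= H x)%E ->
  (\int[mu]_x (H (x ^+ 2)%R * (expR (t * x))%:E) =
   \int[mu]_x (H (x ^+ 2)%R * (expR (`|t| * x))%:E))%E.
Proof.
move=> mH H0; have [t0|t0] := leP 0 t.
  by apply: eq_integral => x _; rewrite ger0_norm.
rewrite [LHS]ge0_integral_opp.
- by apply: eq_integral => x _; rewrite sqrrN ltr0_norm// mulrN mulNr.
- apply: emeasurable_funM; first by apply: (measurableT_comp mH); exact: measurable_funX.
  by apply/measurable_EFinP; apply: measurableT_comp => //; exact: measurable_funM.
- by move=> x; rewrite mule_ge0// lee_fin expR_ge0.
Qed.

(** Induction on the dimension. With the first coordinate frozen, the induction hypothesis, applied
    to [H] shifted by its square, turns the rest of [th] onto a single axis; a planar rotation then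
    merges the two remaining axes, and the norms add by Pythagoras. *)
Lemma ge0_integral_radial_expR n (th : rvec R n.+1) (H : R -> \bar R) :
  measurable_fun setT H -> (forall t, 0 <= H t)%E ->
  (\int[lebesgue_rvec R n.+1]_x (H (sqnorm x) * (expR (dotp th x))%:E) =
   \int[mu]_x \int[lebesgue_rvec R n]_y
     (H (x ^+ 2 + sqnorm y)%R * (expR (Num.sqrt (sqnorm th) * x))%:E))%E.
Proof.
elim: n th H => [|n IH] th H mH H0; (rewrite [LHS]ge0_integral_rvecS_iter;
  [|by have := measurable_sqnorm_expR th 0 mH; under eq_fun do rewrite add0r
   |by move=> x; rewrite mule_ge0// lee_fin expR_ge0]).
- have mk (t x : R) : measurable_fun setT (fun y : rvec R 0 =>
      (H (x ^+ 2 + sqnorm y)%R * (expR t)%:E)%E).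
    apply: emeasurable_funM => //; apply: (measurableT_comp mH).
    by apply: measurable_funD => //; exact: measurable_sqnorm.
  transitivity (\int[mu]_x (H (x ^+ 2)%R * (expR (thead th * x))%:E))%E.
    apply: eq_integral => x _; under eq_integral => y _.
      rewrite sqnorm_cons dotp_cons /dotp big_ord0 addr0; over.
    by rewrite ge0_integral_rvec0// sqnorm0 addr0.
  rewrite ge0_integral_radial_expR_abs//; apply: eq_integral => x _.
  rewrite ge0_integral_rvec0// sqnorm0 addr0 sqnorm_behead sqnorm0 addr0.
  by rewrite sqrtr_sqr.
set th' : rvec R n.+1 := [tuple of behead th].
(* Integrating out the directions orthogonal to both axes leaves a radial weight [K] on the plane,
   to which the two-dimensional case applies. *)
pose K (t : R) := (\int[lebesgue_rvec R n]_z H (t + sqnorm z)%R)%E.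
have mHK : measurable_fun setT (fun z : RR * rvec R n => H (z.1 + sqnorm z.2)).
  apply: (measurableT_comp mH); apply: measurable_funD => //.
  exact: (measurableT_comp (@measurable_sqnorm R n)).
have mK : measurable_fun setT K.
  exact: (@measurable_fun_fubini_tonelli_F _ _ _ _ _ (lebesgue_rvec R n) _ mHK (fun _ => H0 _)).
have K0 t : (0 <= K t)%E by apply: integral_ge0.
have intK (t c : R) : (\int[lebesgue_rvec R n]_z (H (t + sqnorm z)%R * (expR c)%:E) =
    K t * (expR c)%:E)%E.
  rewrite ge0_integralZr//.
  apply: (measurableT_comp mH); apply: measurable_funD => //.
  exact: measurable_sqnorm.
have shiftH (t : R) : measurable_fun setT (fun u : R => H (t + u)).
  by apply: (measurableT_comp mH); exact: measurable_funD.
transitivity (\int[mu]_x \int[mu]_u (K (x ^+ 2 + u ^+ 2)%R *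
    (expR (thead th * x + Num.sqrt (sqnorm th') * u))%:E))%E.
  apply: eq_integral => x _.
  transitivity (\int[lebesgue_rvec R n.+1]_y ((expR (thead th * x))%:E *
     (H (x ^+ 2 + sqnorm y)%R * (expR (dotp th' y))%:E)))%E.
    apply: eq_integral => y _; rewrite sqnorm_cons dotp_cons expRD EFinM.
    by rewrite muleCA.
  rewrite ge0_integralZl; last 4 first.
  - by [].
  - exact: measurable_sqnorm_expR.
  - by move=> y _; rewrite mule_ge0// lee_fin expR_ge0.
  - by rewrite lee_fin expR_ge0.
  rewrite (IH th' (fun u => H (x ^+ 2 + u)))// -ge0_integralZl; last 4 first.
  - by [].
  - under eq_fun => u do (under eq_integral do rewrite addrA; rewrite intK).
    apply: emeasurable_funM; last first.
      by apply/measurable_EFinP; apply: measurableT_comp => //; exact: measurable_funM.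
    apply: (measurableT_comp mK); apply: measurable_funD => //; exact: measurable_funX.
  - by move=> y _; apply: integral_ge0 => u _; rewrite mule_ge0// lee_fin expR_ge0.
  - by rewrite lee_fin expR_ge0.
  apply: eq_integral => u _; under eq_integral do rewrite addrA.
  by rewrite intK expRD EFinM muleCA.
rewrite ge0_integral_radial_expR2// sqr_sqrtr ?sqnorm_ge0// -sqnorm_behead.
apply: eq_integral => x _.
rewrite [RHS]ge0_integral_rvecS_iter; last 2 first.
- apply: emeasurable_funM => //; apply: (measurableT_comp mH).
  by apply: measurable_funD => //; exact: measurable_sqnorm.
- by move=> y; rewrite mule_ge0// lee_fin expR_ge0.
apply: eq_integral => u _; under [RHS]eq_integral do rewrite sqnorm_cons addrA.
by rewrite intK.
Qed.

End radial_integration.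

(** * Integration against a measure given by a density *)

Section density.
Local Open Scope ereal_scope.
Context d (T : measurableType d) (R : realType).
Variables (mu nu : {measure set T -> \bar R}) (p : T -> R).
Hypothesis mp : measurable_fun setT p.
Hypothesis p0 : forall x, (0 <= p x)%R.
Hypothesis nuE : forall A, measurable A -> nu A = \int[mu]_(x in A) (p x)%:E.

Import HBNNSimple.

Let nnsfun_density (h : {nnsfun T >-> R}) :
  \int[nu]_x (h x)%:E = \int[mu]_x ((h x)%:E * (p x)%:E).
Proof.
have mEp : measurable_fun setT (EFin \o p) by exact/measurable_EFinP.
under eq_integral do rewrite fimfunE -fsumEFin//.
rewrite ge0_integral_fsum//; last 2 first.
- by move=> y; exact/measurable_EFinP/measurable_funM.
- by move=> y x _; rewrite nnfun_muleindic_ge0.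
transitivity (\sum_(y \in range h)
    \int[mu]_x ((y * \1_(h @^-1` [set y]) x)%:E * (p x)%:E)).
  apply: eq_fsbigr => y _.
  rewrite integralZl_indic_nnsfun// integral_indic// setIT nuE//.
  have [y0|y0] := leP 0%R y; last first.
    rewrite preimage_nnfun0// integral_set0 mule0 integral0_eq// => x _.
    by rewrite indic0 mulr0 mul0e.
  under [RHS]eq_integral do rewrite EFinM -muleA.
  rewrite ge0_integralZl//; last 2 first.
  - by apply: emeasurable_funM => //; exact/measurable_EFinP.
  - by move=> x _; rewrite mule_ge0// lee_fin.
  congr (_ * _); rewrite integral_mkcond; apply: eq_integral => x _.
  by rewrite /= epatch_indic muleC.
rewrite -ge0_integral_fsum//; last 2 first.
- move=> y; apply: emeasurable_funM => //.
  by apply/measurable_EFinP/measurable_funM.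
- move=> y x _; rewrite mule_ge0 ?lee_fin// -lee_fin EFinM.
  by rewrite nnfun_muleindic_ge0.
apply: eq_integral => x _.
rewrite -ge0_mule_fsuml; last by move=> y; rewrite nnfun_muleindic_ge0.
by rewrite fsumEFin// -fimfunE.
Qed.

(** The normal law is specified by its values on sets. Nonnegative simple functions and monotone
    convergence carry the formula over to functions. *)
Lemma ge0_integral_density (f : T -> \bar R) :
  measurable_fun setT f -> (forall x, 0 <= f x) ->
  \int[nu]_x f x = \int[mu]_x (f x * (p x)%:E).
Proof.
move=> mf f0; pose f_ := nnsfun_approx measurableT mf.
have f_f x : (f_ n x)%:E @[n --> \oo] --> f x by exact: cvg_nnsfun_approx.
transitivity (limn (fun n => \int[nu]_x (f_ n x)%:E)).
  rewrite -monotone_convergence//=.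
  - by apply: eq_integral => x _; apply/esym/cvg_lim => //; exact: f_f.
  - by move=> n; exact/measurable_EFinP/measurable_funTS.
  - by move=> n x _; rewrite lee_fin.
  - by move=> x _ m n mn; rewrite lee_fin; exact/lefP/nd_nnsfun_approx.
under eq_fun do rewrite nnsfun_density.
rewrite -monotone_convergence//=.
- apply: eq_integral => x _; apply/cvg_lim => //.
  by apply: cvgeMr => //; exact: f_f.
- move=> n; apply: emeasurable_funM; last exact/measurable_EFinP.
  exact/measurable_EFinP/measurable_funTS.
- by move=> n x _; rewrite mule_ge0 ?lee_fin.
- move=> x _ m n mn; apply: lee_wpmul2r; first by rewrite lee_fin.
  by rewrite lee_fin; exact/lefP/nd_nnsfun_approx.
Qed.

End density.

(** * The expectation as an integral over R x R^(p-1) *)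

Section expectation_radial.
Context {R : realType}.
Local Notation mu := (@lebesgue_measure R).
Local Notation RR := (measurableTypeR R).

(** The radial factor of the normal density in dimension [n] once [|x - th|^2] is expanded; [t] is
    the squared radius. *)
Definition radial_weight n (t : R) : R :=
  (2 * pi) `^ (- (n%:R / 2)) * expR (- (t / 2)).

Lemma radial_weight_ge0 n t : 0 <= radial_weight n t.
Proof. by rewrite mulr_ge0 ?powR_ge0 ?expR_ge0. Qed.

Lemma measurable_radial_weight n : measurable_fun setT (radial_weight n).
Proof.
apply: measurable_funM => //; apply: measurableT_comp => //.
by apply: measurableT_comp => //; exact: measurable_funM.
Qed.

Lemma sqnorm_rvec_sub n (x th : rvec R n) :
  sqnorm (rvec_sub x th) = sqnorm x - 2 * dotp th x + sqnorm th.
Proof.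
rewrite /sqnorm /dotp mulr_sumr -sumrB -big_split/=; apply: eq_bigr => i _.
by rewrite tnth_mktuple; ring.
Qed.

Lemma mvnormal_pdf_radial n (th x : rvec R n) :
  mvnormal_pdf th x =
  radial_weight n (sqnorm x) * expR (dotp th x) * expR (- (sqnorm th / 2)).
Proof.
rewrite /mvnormal_pdf enorm_sq -/(sqnorm _) sqnorm_rvec_sub.
rewrite /radial_weight -!mulrA; congr (_ * _); rewrite -!expRD; congr expR.
by field.
Qed.

Variables (d : measure_display) (T : measurableType d) (P : probability T R).
Variables (n : nat) (th : rvec R n.+1) (X : {RV P >-> rvec R n.+1}).
Hypothesis XN : is_mvnormal X th.

(** After expansion, [dotp th x] is the only non-radial term of the exponent. The constant
    [exp(-|th|^2 / 2)] is absorbed into the radial function [K], so that rotation invariance applies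
    to what remains. *)
Lemma ge0_integral_mvnormal_radial (H : R -> \bar R) :
  measurable_fun setT H -> (forall t, 0 <= H t)%E ->
  (\int[P]_t H (sqnorm (X t)) =
   \int[mu \x lebesgue_rvec R n]_z (H (z.1 ^+ 2 + sqnorm z.2)%R *
     (radial_weight n.+1 (z.1 ^+ 2 + sqnorm z.2) *
      expR (enorm th * z.1 - enorm th ^+ 2 / 2))%:E))%E.
Proof.
move=> mH H0.
have mHs : measurable_fun setT (fun x : rvec R n.+1 => H (sqnorm x)).
  by apply: (measurableT_comp mH); exact: measurable_sqnorm.
rewrite -(ge0_integral_distribution X mHs (fun _ => H0 _)).
rewrite (@ge0_integral_density _ _ _ (lebesgue_rvec R n.+1) _ (mvnormal_pdf th))//;
  [|exact: measurable_mvnormal_pdf|exact: mvnormal_pdf_ge0].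
pose K (t : R) : \bar R :=
  (H t * (radial_weight n.+1 t * expR (- (sqnorm th / 2)))%:E)%E.
have mK : measurable_fun setT K.
  apply: emeasurable_funM => //; apply/measurable_EFinP; apply: measurable_funM => //.
  exact: measurable_radial_weight.
have K0 t : (0 <= K t)%E.
  by rewrite mule_ge0// lee_fin mulr_ge0// ?expR_ge0// radial_weight_ge0.
transitivity (\int[lebesgue_rvec R n.+1]_x (K (sqnorm x) * (expR (dotp th x))%:E))%E.
  apply: eq_integral => x _; rewrite /K -muleA -EFinM mvnormal_pdf_radial.
  by congr (_ * _%:E)%E; ring.
rewrite ge0_integral_radial_expR//.
rewrite [RHS](_ : _ = \int[mu \x lebesgue_rvec R n]_z
    (K (z.1 ^+ 2 + sqnorm z.2)%R * (expR (Num.sqrt (sqnorm th) * z.1))%:E))%E.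
  rewrite [RHS]fubini_tonelli1//.
    exact: (measurable_radial_expR _ mK).
  by move=> z; rewrite mule_ge0// lee_fin expR_ge0.
apply: eq_integral => z _; rewrite /K -muleA -EFinM -/(enorm th).
congr (_ * _%:E)%E; rewrite enorm_sq -/(sqnorm th) [X in expR X]addrC expRD.
exact: mulrA.
Qed.

(** The weight is nonnegative, so multiplying by it commutes with taking positive and negative
    parts. The identity therefore holds between extended reals before any integrability is
    established. *)
Lemma expectation_mvnormal_radial (phi : R -> R) : measurable_fun setT phi ->
  ('E_P[(fun t => phi (enorm (X t) ^+ 2))%R] =
   \int[mu \x lebesgue_rvec R n]_z (phi (z.1 ^+ 2 + sqnorm z.2) *
     radial_weight n.+1 (z.1 ^+ 2 + sqnorm z.2) *
      expR (enorm th * z.1 - enorm th ^+ 2 / 2))%:E)%E.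
Proof.
move=> mphi; rewrite unlock integralE [RHS]integralE.
have mphiE : measurable_fun setT (EFin \o phi) by exact/measurable_EFinP.
have w0 (z : RR * rvec R n) : 0 <= radial_weight n.+1 (z.1 ^+ 2 + sqnorm z.2) *
    expR (enorm th * z.1 - enorm th ^+ 2 / 2).
  by rewrite mulr_ge0 ?radial_weight_ge0 ?expR_ge0.
congr (_ - _)%E.
- transitivity (\int[P]_t (EFin \o phi)^\+ (sqnorm (X t)))%E.
    by apply: eq_integral => t _; rewrite !funeposE/= enorm_sq.
  rewrite ge0_integral_mvnormal_radial//; last exact: measurable_funepos.
  apply: eq_integral => z _; rewrite !funeposE/= -mulrA -!EFin_max -EFinM.
  by rewrite maxr_pMl// mul0r.
- transitivity (\int[P]_t (EFin \o phi)^\- (sqnorm (X t)))%E.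
    by apply: eq_integral => t _; rewrite !funenegE/= enorm_sq.
  rewrite ge0_integral_mvnormal_radial//; last exact: measurable_funeneg.
  apply: eq_integral => z _; rewrite !funenegE/= -mulrA -!EFin_max -EFinM.
  by rewrite maxr_pMl// mul0r mulNr.
Qed.

End expectation_radial.

(** * Gaussian integrals *)

Section gaussian_integrals.
Context {R : realType}.
Local Notation mu := (@lebesgue_measure R).
Local Notation RR := (measurableTypeR R).
Local Open Scope ereal_scope.

Lemma integral_expR_sqr (c : R) : (0 < c)%R ->
  \int[mu]_x (expR (- (c * x ^+ 2)))%:E = (Num.sqrt (pi / c))%:E.
Proof.
move=> c0; have s0 : (0 < Num.sqrt c)%R by rewrite sqrtr_gt0.
have := @integralT_gauss R.
rewrite (@ge0_integral_affine _ (Num.sqrt c) 0); first last.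
- by move=> x; rewrite lee_fin gauss_fun_ge0.
- by apply/measurable_EFinP; exact: measurable_gauss_fun.
- exact: lt0r_neq0.
under eq_integral => x _.
  rewrite /gauss_fun addr0 exprMn sqr_sqrtr; last exact: ltW.
  over.
move=> /(congr1 (fun t => (Num.sqrt c)^-1%:E * t)).
rewrite muleA -EFinM gtr0_norm// mulVf ?gt_eqF// mul1e => ->.
by rewrite -EFinM sqrtrM ?pi_ge0// sqrtrV ?ltW// mulrC.
Qed.

Lemma integral_rvec_expR_sqnorm n (c : R) : (0 < c)%R ->
  \int[lebesgue_rvec R n]_y (expR (- (c * sqnorm y)))%:E =
    (Num.sqrt (pi / c) ^+ n)%:E.
Proof.
move=> c0.
have mg m : measurable_fun setT (fun y : rvec R m => (expR (- (c * sqnorm y)))%:E).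
  apply/measurable_EFinP/measurableT_comp => //; apply: measurableT_comp => //.
  by apply: measurable_funM => //; exact: measurable_sqnorm.
elim: n => [|n IH]; first by rewrite ge0_integral_rvec0// sqnorm0 mulr0 oppr0 expR0.
rewrite ge0_integral_rvecS_iter//.
transitivity (\int[mu]_x ((expR (- (c * x ^+ 2)))%:E * (Num.sqrt (pi / c) ^+ n)%:E)).
  apply: eq_integral => x _.
  under eq_integral do rewrite sqnorm_cons mulrDr opprD expRD EFinM.
  by rewrite ge0_integralZl//; [rewrite IH|exact: mg].
rewrite ge0_integralZr//.
- by rewrite integral_expR_sqr// exprS EFinM.
- apply/measurable_EFinP/measurableT_comp => //; apply: measurableT_comp => //.
  exact: measurable_funM.
Qed.

Lemma integral_expR_radial n (c : R) : (0 < c)%R ->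
  \int[mu \x lebesgue_rvec R n]_z (expR (- (c * (z.1 ^+ 2 + sqnorm z.2))))%:E =
    (Num.sqrt (pi / c) ^+ n.+1)%:E.
Proof.
move=> c0; rewrite -integral_rvec_expR_sqnorm// ge0_integral_rvecS//; last first.
- apply/measurable_EFinP/measurableT_comp => //; apply: measurableT_comp => //.
  by apply: measurable_funM => //; exact: measurable_sqnorm.
by apply: eq_integral => -[x y] _; rewrite sqnorm_cons.
Qed.

End gaussian_integrals.

(** * Integrability of the singularity at the origin *)

Section radial_singularity.
Context {R : realType}.
Local Notation mu := (@lebesgue_measure R).
Local Notation RR := (measurableTypeR R).

Lemma measurable_sqradius n :
  measurable_fun setT (fun z : RR * rvec R n => z.1 ^+ 2 + sqnorm z.2).
Proof.
apply: measurable_funD; first exact: measurable_funX.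
exact: (measurableT_comp (@measurable_sqnorm R n)).
Qed.

(** The least [m] with [r / 2^m < t] is [j + 1]: minimality gives the upper bound, and [m = 0] is
    excluded by [t <= r]. Such an [m] exists because [r / t < m <= 2^m] for large [m]. *)
Lemma dyadic_scale (r t : R) : 0 < t <= r ->
  exists j, r / 2 ^+ j.+1 < t <= r / 2 ^+ j.
Proof.
move=> /andP[t0 tr]; have r0 : 0 < r by exact: lt_le_trans tr.
have ex : exists m, r / 2 ^+ m < t.
  exists (Num.trunc (r / t)).+1; rewrite ltr_pdivrMr ?exprn_gt0//.
  rewrite mulrC -ltr_pdivrMr//; apply: lt_le_trans (truncnS_gt _) _.
  by rewrite -natrX ler_nat ltnW// ltn_expl.
case: (ex_minnP ex) => -[|j] tj jmin.
  by move: tj; rewrite expr0 divr1 ltNge tr.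
exists j; rewrite tj/= leNgt; apply/negP => /jmin.
by rewrite ltnn.
Qed.

Variables (n : nat) (k : R -> R) (a M : R).
Hypothesis a0 : 0 < a.
Hypothesis mk : measurable_fun setT k.
Hypothesis kM : forall w, 0 < w <= a -> w `^ (n%:R / 2) * `|k w| <= M.
Hypothesis k0 : forall w, ~~ (0 < w <= a) -> k w = 0.

Let r := Num.sqrt a.
Let r0 : 0 < r. Proof. by rewrite sqrtr_gt0. Qed.

(* On the dyadic shell r / 2^(j+1) < sqrt w <= r / 2^j the j-th Gaussian
   dominates k, because its exponent is nonnegative there. *)
Let majorant (j : nat) (w : R) : R :=
  M * (2 ^+ j.+1 / r) ^+ n * expR (1 - (2 ^+ j / r) ^+ 2 * w).

Let M0 : 0 <= M.
Proof.
apply: le_trans (kM (w := a) _); last by rewrite a0 lexx.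
by rewrite mulr_ge0 ?powR_ge0.
Qed.

Let majorant_ge0 j w : 0 <= majorant j w.
Proof.
by rewrite !mulr_ge0 ?expR_ge0// exprn_ge0// divr_ge0 ?exprn_ge0// ltW.
Qed.

(** The lower end of the shell bounds [w^(-n/2)] by [(2^(j+1) / r)^n]; the upper end makes the
    exponential at least 1. *)
Let norm_le_majorant w : exists j, `|k w| <= majorant j w.
Proof.
have [w0|w0] := boolP (0 < w <= a); last first.
  by exists 0; rewrite k0// normr0 majorant_ge0.
have /andP[wp wa] := w0.
have sw0 : 0 < Num.sqrt w by rewrite sqrtr_gt0.
have [|j /andP[jl ju]] := @dyadic_scale r (Num.sqrt w).
  by rewrite sw0/= ler_wsqrtr.
exists j; apply: (@le_trans _ _ (M * (2 ^+ j.+1 / r) ^+ n)).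
  have := kM w0.
  have -> : w `^ (n%:R / 2) = Num.sqrt w ^+ n.
    by rewrite mulrC powRrM powR_mulrn ?powR_ge0// powR12_sqrt// ltW.
  rewrite mulrC -ler_pdivlMr ?exprn_gt0// => /le_trans; apply.
  rewrite ler_wpM2l// -exprVn lerXn2r ?nnegrE ?invr_ge0 ?ltW//.
    by rewrite divr_gt0// exprn_gt0.
  by rewrite -(invf_div r) ltf_pV2 ?posrE// divr_gt0// exprn_gt0.
rewrite ler_peMr//.
  by rewrite mulr_ge0// exprn_ge0// divr_ge0 ?exprn_ge0// ltW.
rewrite -[leLHS]expR0 ler_expR subr_ge0.
have -> : (2 ^+ j / r) ^+ 2 * w = (2 ^+ j / r * Num.sqrt w) ^+ 2.
  by rewrite [RHS]exprMn sqr_sqrtr// ltW.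
rewrite exprn_ile1//.
  by rewrite mulr_ge0 ?divr_ge0 ?exprn_ge0// ltW.
by rewrite mulrC -ler_pdivlMr ?divr_gt0 ?exprn_gt0// invf_div mul1r.
Qed.

(** In dimension [n + 1] the [j]-th majorant has height of order [2^(j n)] and a Gaussian volume of
    order [2^(-j (n+1))]. Its integral is of order [2^(-j)], and the series converges. *)
Lemma integral_radial_lty :
  (\int[mu \x lebesgue_rvec R n]_z `|(k (z.1 ^+ 2 + sqnorm z.2))%:E| < +oo)%E.
Proof.
pose w (z : RR * rvec R n) := z.1 ^+ 2 + sqnorm z.2.
have mw : measurable_fun setT w.
  exact: measurable_sqradius.
have mE c : measurable_fun setT (fun z => (expR (- (c * w z)))%:E).
  apply/measurable_EFinP; apply: measurableT_comp => //; apply: measurableT_comp => //.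
  exact: measurable_funM.
have mmaj j : measurable_fun setT (fun z => (majorant j (w z))%:E).
  apply/measurable_EFinP; apply: measurable_funM => //.
  apply: measurableT_comp => //; apply: measurable_funB => //.
  exact: measurable_funM.
apply: (@le_lt_trans _ _
    (\int[mu \x lebesgue_rvec R n]_z \sum_(0 <= j <oo) (majorant j (w z))%:E)%E).
  apply: ge0_le_integral => //.
  - apply: measurableT_comp => //; apply/measurable_EFinP.
    exact: (measurableT_comp mk).
  - have := @ge0_emeasurable_sum _ _ _ setT (fun j z => (majorant j (w z))%:E) predT.
    by apply => // j z _ _; rewrite lee_fin majorant_ge0.
  - move=> z _; have [j jz] := norm_le_majorant (w z).
    apply: (@le_trans _ _ (majorant j (w z))%:E); first by rewrite lee_fin.
    apply: le_trans (@nneseries_lim_ge _ _ predT 0 j.+1 _); last first.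
      by move=> i _ _; rewrite lee_fin majorant_ge0.
    rewrite big_nat_recr//= leeDr// sume_ge0// => i _.
    by rewrite lee_fin majorant_ge0.
rewrite integral_nneseries//; last by move=> j z _; rewrite lee_fin majorant_ge0.
pose K : R := M * 2 ^+ n * expR 1 * (Num.sqrt pi ^+ n.+1 * r).
have K0 : 0 <= K.
  by rewrite !mulr_ge0 ?expR_ge0 ?exprn_ge0 ?sqrtr_ge0.
(* The integral of the [j]-th majorant is exactly [K / 2^j]; the factor 2 fits it to the geometric
   series with denominators [2^(j+1)]. *)
apply: (@le_lt_trans _ _ (\sum_(0 <= j <oo) (2 * K / (2 ^ j.+1)%:R)%:E)%E); last first.
  apply: le_lt_trans (@epsilon_trick0 R (2 * K) predT _) _; last by rewrite ltry.
  by rewrite mulr_ge0.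
apply: lee_nneseries => [j _ _|j _].
  by apply: integral_ge0 => z _; rewrite lee_fin majorant_ge0.
set q : R := 2 ^+ j / r; have q0 : 0 < q by rewrite divr_gt0 ?exprn_gt0.
under eq_integral => z _.
  rewrite /majorant expRD mulrA EFinM; over.
rewrite ge0_integralZl//; last first.
  by rewrite lee_fin !mulr_ge0 ?expR_ge0// exprn_ge0// divr_ge0 ?exprn_ge0// ltW.
rewrite integral_expR_radial ?exprn_gt0//.
rewrite -EFinM lee_fin sqrtrM ?pi_ge0// sqrtrV ?sqr_ge0// sqrtr_sqr gtr0_norm//.
rewrite natrX /K (_ : 2 ^+ j.+1 / r = 2 * q); last by rewrite exprS mulrA.
rewrite -/q; have -> : r = 2 ^+ j / q.
  by rewrite /q invf_div mulrCA divff ?mulr1// expf_neq0.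
move: q q0 => q q0.
rewrite !exprMn [q^-1 ^+ _]exprS exprVn [Num.sqrt pi ^+ _]exprS.
rewrite exprS.
have qn0 : q ^+ n != 0 by rewrite expf_neq0// gt_eqF.
have jn0 : 2 ^+ j != 0 :> R by rewrite expf_neq0.
have q0' := lt0r_neq0 q0.
move: (q ^+ n) (2 ^+ j) (2 ^+ n) qn0 jn0 => Q J N Q0 J0.
rewrite le_eqVlt; apply/orP; left; apply/eqP; field.
by rewrite J0 q0'.
Qed.

End radial_singularity.

(** * Anisotropic dilations *)

Section anisotropic_scaling.
Context {R : realType}.
Local Notation mu := (@lebesgue_measure R).
Local Notation RR := (measurableTypeR R).

(** One dilation of the line per coordinate, by induction: the induction hypothesis is applied to
    [Phi] shifted by the square of the coordinate split off. *)
Lemma ge0_integral_scale_sqnorm n (c : R) (Phi : R -> \bar R) : 0 < c ->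
  measurable_fun setT Phi -> (forall t, 0 <= Phi t)%E ->
  (\int[lebesgue_rvec R n]_y Phi (sqnorm y) =
   (c ^+ n)%:E * \int[lebesgue_rvec R n]_y Phi (c ^+ 2 * sqnorm y)%R)%E.
Proof.
move=> c0; elim: n Phi => [|n IH] Phi mPhi Phi0.
  rewrite !ge0_integral_rvec0//.
  - by rewrite sqnorm0 mulr0 expr0 mul1e.
  - apply: (measurableT_comp mPhi); apply: measurable_funM => //.
    exact: measurable_sqnorm.
  - by apply: (measurableT_comp mPhi); exact: measurable_sqnorm.
have mPhiD t : measurable_fun setT (fun u : R => Phi (t + u)).
  by apply: (measurableT_comp mPhi); exact: measurable_funD.
rewrite !ge0_integral_rvecS_iter//; last 2 first.
- apply: (measurableT_comp mPhi); apply: measurable_funM => //.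
  exact: measurable_sqnorm.
- by apply: (measurableT_comp mPhi); exact: measurable_sqnorm.
pose F (x : RR) : \bar R :=
  (\int[lebesgue_rvec R n]_y Phi (x ^+ 2 + c ^+ 2 * sqnorm y)%R)%E.
have mPhi2 : measurable_fun setT (fun z : RR * rvec R n =>
    Phi (z.1 ^+ 2 + c ^+ 2 * sqnorm z.2)).
  apply: (measurableT_comp mPhi); apply: measurable_funD.
    exact: measurable_funX.
  by apply: measurable_funM => //; exact: (measurableT_comp (@measurable_sqnorm R n)).
have mF : measurable_fun setT F.
  exact: (@measurable_fun_fubini_tonelli_F _ _ _ _ _ (lebesgue_rvec R n) _ mPhi2 (fun _ => Phi0 _)).
have F0 x : (0 <= F x)%E by exact: integral_ge0.
transitivity (\int[mu]_x ((c ^+ n)%:E * F x))%E.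
  apply: eq_integral => x _; rewrite -(IH (fun u => Phi (x ^+ 2 + u)))//.
  by apply: eq_integral => y _; rewrite sqnorm_cons.
rewrite [LHS]ge0_integralZl; [|by []|exact: mF|by move=> x _; exact: F0
  |by rewrite lee_fin exprn_ge0// ltW].
rewrite (@ge0_integral_affine _ c 0 F) ?gt_eqF//.
rewrite [LHS]muleA -[X in (X * _)%E = _]EFinM (gtr0_norm c0) -exprSr.
congr mule.
apply: eq_integral => x _; apply: eq_integral => y _.
by rewrite addr0 sqnorm_cons exprMn mulrDr.
Qed.

(** The transverse variable is dilated for each fixed first coordinate, which is then replaced by
    [d - c1 v]. With this orientation [v] measures depth inwards from [d]. *)
Lemma ge0_integral_scale n (d c1 c2 : R) (Psi : RR * RR -> \bar R) :
  0 < c1 -> 0 < c2 -> measurable_fun setT Psi -> (forall z, 0 <= Psi z)%E ->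
  (\int[mu \x lebesgue_rvec R n]_z Psi (z.1, sqnorm z.2) =
   \int[mu \x lebesgue_rvec R n]_z
     ((c1 * c2 ^+ n)%:E * Psi (d - c1 * z.1, c2 ^+ 2 * sqnorm z.2)%R))%E.
Proof.
move=> c10 c20 mPsi Psi0.
have mP (f : RR * rvec R n -> RR) (g : RR * rvec R n -> RR) :
    measurable_fun setT f -> measurable_fun setT g ->
    measurable_fun setT (fun z => Psi (f z, g z)).
  by move=> mf mg; apply: (measurableT_comp mPsi); exact/measurable_fun_pair.
have msq : measurable_fun setT (fun z : RR * rvec R n => sqnorm z.2).
  exact: (measurableT_comp (@measurable_sqnorm R n)).
have mPx x : measurable_fun setT (fun t : R => Psi (x, t)).
  by apply: (measurableT_comp mPsi); exact/measurable_fun_pair.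
have mS : measurable_fun setT (fun z : RR * rvec R n =>
    Psi (d - c1 * z.1, c2 ^+ 2 * sqnorm z.2)).
  apply: mP; first by apply: measurable_funB => //; exact: measurable_funM.
  exact: measurable_funM.
rewrite ge0_integralZl//; last by rewrite lee_fin mulr_ge0 ?exprn_ge0// ltW.
rewrite !fubini_tonelli1//; last exact: mP.
rewrite /fubini_F/=.
pose F (x : RR) : \bar R :=
  (\int[lebesgue_rvec R n]_y Psi (x, c2 ^+ 2 * sqnorm y)%R)%E.
have mF : measurable_fun setT F.
  apply: (@measurable_fun_fubini_tonelli_F _ _ _ _ _ (lebesgue_rvec R n)
    (fun z : RR * rvec R n => Psi (z.1, c2 ^+ 2 * sqnorm z.2))) => //.
  by apply: mP => //; exact: measurable_funM.
have F0 x : (0 <= F x)%E by exact: integral_ge0.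
transitivity (\int[mu]_x ((c2 ^+ n)%:E * F x))%E.
  by apply: eq_integral => x _; exact: (ge0_integral_scale_sqnorm n c20 (mPx x)).
rewrite [LHS]ge0_integralZl; [|by []|exact: mF|by move=> x _; exact: F0
  |by rewrite lee_fin exprn_ge0// ltW].
rewrite (@ge0_integral_affine _ (- c1) d F) ?oppr_eq0 ?gt_eqF//.
rewrite [LHS]muleA -[X in (X * _)%E = _]EFinM normrN (gtr0_norm c10) [c2 ^+ n * c1]mulrC.
congr mule.
by apply: eq_integral => x _; rewrite mulNr addrC.
Qed.

Lemma integral_scale n (d c1 c2 : R) (psi : RR * RR -> R) :
  0 < c1 -> 0 < c2 -> measurable_fun setT psi ->
  (\int[mu \x lebesgue_rvec R n]_z (psi (z.1, sqnorm z.2))%:E =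
   \int[mu \x lebesgue_rvec R n]_z
     (c1 * c2 ^+ n * psi (d - c1 * z.1, c2 ^+ 2 * sqnorm z.2))%:E)%E.
Proof.
move=> c10 c20 mpsi.
have mpsiE : measurable_fun setT (EFin \o psi) by exact/measurable_EFinP.
have c0 : 0 <= c1 * c2 ^+ n by rewrite mulr_ge0 ?exprn_ge0// ltW.
rewrite integralE [RHS]integralE; congr (_ - _)%E.
- transitivity (\int[mu \x lebesgue_rvec R n]_z (EFin \o psi)^\+ (z.1, sqnorm z.2))%E.
    by apply: eq_integral => z _; rewrite !funeposE.
  rewrite (ge0_integral_scale n d c10 c20)//; last exact: measurable_funepos.
  apply: eq_integral => z _; rewrite !funeposE/= -!EFin_max -EFinM.
  by rewrite maxr_pMr// mulr0.
- transitivity (\int[mu \x lebesgue_rvec R n]_z (EFin \o psi)^\- (z.1, sqnorm z.2))%E.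
    by apply: eq_integral => z _; rewrite !funenegE.
  rewrite (ge0_integral_scale n d c10 c20)//; last exact: measurable_funeneg.
  apply: eq_integral => z _; rewrite !funenegE/= -!EFin_max -EFinM.
  by rewrite maxr_pMr// mulr0 mulrN.
Qed.

End anisotropic_scaling.

(** * The limit profile and its integral *)

Section laplace_profile.
Context {R : realType}.
Local Notation mu := (@lebesgue_measure R).
Local Notation RR := (measurableTypeR R).

(* Unlike [powR], which gives 0 `^ 0 = 1, this vanishes on ]-oo, 0] for every b. *)
Definition pos_powR (b u : R) : R := if 0 < u then u `^ b else 0.

Lemma pos_powR_ge0 b u : 0 <= pos_powR b u.
Proof. by rewrite /pos_powR; case: ifP => // _; exact: powR_ge0. Qed.

Lemma measurable_pos_powR b : measurable_fun setT (pos_powR b).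
Proof.
apply: measurable_fun_ifT => //; exact: measurable_fun_ltr.
Qed.

Lemma pos_powRM b c u : 0 < c -> pos_powR b (c * u) = c `^ b * pos_powR b u.
Proof.
move=> c0; rewrite /pos_powR pmulr_rgt0//; case: ifP => u0; last by rewrite mulr0.
by rewrite powRM// ltW.
Qed.

(** Raise [t <= c exp(t / c)] to the power [b]; the exponent becomes [t b / c <= t / 2]. Taking
    [c = 2 (b + 1)] rather than [2 b] keeps [c] positive at [b = 0]. *)
Lemma powR_le_expR (b t : R) : 0 <= b -> 0 <= t ->
  t `^ b <= (2 * (b + 1)) `^ b * expR (t / 2).
Proof.
move=> b0 t0; set c := 2 * (b + 1).
have c0 : 0 < c by rewrite /c; lra.
have tc : t <= c * expR (t / c).
  rewrite -ler_pdivrMl// mulrC; apply: le_trans (expR_ge1Dx _).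
  by rewrite lerDr.
apply: (@le_trans _ _ ((c * expR (t / c)) `^ b)).
  by rewrite ge0_ler_powR// nnegrE// mulr_ge0 ?expR_ge0// ltW.
rewrite powRM ?expR_ge0 ?(ltW c0)// -expRM ler_wpM2l ?powR_ge0// ler_expR.
rewrite mulrAC ler_pdivrMr// (_ : t / 2 * c = t * b + t) ?lerDl// /c.
by field.
Qed.

(** [Gamma] is the [fine] of an extended integral, so the point is finiteness, obtained by
    comparison with an exponential density of rate 1/2. *)
Lemma integral_pos_powR_expR (b : R) : 0 <= b ->
  (\int[mu]_t (pos_powR b t * expR (- t))%:E = (Gamma (b + 1))%:E)%E.
Proof.
move=> b0.
have mf : measurable_fun setT (fun t : RR => (pos_powR b t * expR (- t))%:E).
  apply/measurable_EFinP; apply: measurable_funM; [exact: measurable_pos_powR|exact: measurableT_comp].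
have -> : Gamma (b + 1) = fine (\int[mu]_t (pos_powR b t * expR (- t))%:E)%E.
  rewrite /Gamma /Rintegral integral_mkcond; congr fine.
  apply: eq_integral => t _; rewrite patchE mem_setE in_itv/= andbT addrK /pos_powR.
  by case: ifP => //; rewrite mul0r.
rewrite fineK// ge0_fin_numE; last first.
  by apply: integral_ge0 => t _; rewrite lee_fin mulr_ge0 ?pos_powR_ge0 ?expR_ge0.
have h2 : 0 < 2^-1 :> R by rewrite invr_gt0.
pose C : R := 2 * (2 * (b + 1)) `^ b.
have C0 : 0 <= C by rewrite mulr_ge0 ?powR_ge0.
have mE : measurable_fun setT (fun t : RR => (exponential_pdf 2^-1 t : R)%:E).
  by apply/measurable_EFinP; exact: measurable_exponential_pdf.
apply: (@le_lt_trans _ _ (\int[mu]_t (C%:E * (exponential_pdf 2^-1 t)%:E))%E).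
  apply: ge0_le_integral => //.
  - by move=> t _; rewrite lee_fin mulr_ge0 ?pos_powR_ge0 ?expR_ge0.
  - exact: measurable_funeM.
  - move=> t _; rewrite -EFinM lee_fin /pos_powR; case: ifP => t0; last first.
      by rewrite mul0r mulr_ge0// exponential_pdf_ge0// ltW.
    rewrite (exponential_pdfE _ (ltW t0)).
    apply: (@le_trans _ _ ((2 * (b + 1)) `^ b * expR (t / 2) * expR (- t))).
      by rewrite ler_wpM2r ?expR_ge0// powR_le_expR// ltW.
    rewrite -mulrA -expRD /C (_ : t / 2 - t = - 2^-1 * t); last by field.
    by rewrite mulrACA divff// mul1r.
rewrite ge0_integralZl//; last by move=> t _; rewrite lee_fin exponential_pdf_ge0// ltW.
by rewrite integral_exponential_pdf// mule1 ltry.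
Qed.

(** The second coordinate stands for the squared norm of the transverse variable [eta]. *)
Definition laplace_profile (r b : R) (z : RR * RR) : R :=
  pos_powR b (2 * r * z.1 - z.2) * expR (- z.1).

Lemma laplace_profile_ge0 r b z : 0 <= laplace_profile r b z.
Proof. by rewrite mulr_ge0 ?pos_powR_ge0 ?expR_ge0. Qed.

Lemma measurable_laplace_profile r b n :
  measurable_fun setT (fun z : RR * rvec R n => laplace_profile r b (z.1, sqnorm z.2)).
Proof.
rewrite /laplace_profile/=; apply: measurable_funM; last first.
  apply: (@measurableT_comp _ _ _ _ _ _ (@expR R)) => //; exact: measurable_funN.
apply: (measurableT_comp (measurable_pos_powR b)); apply: measurable_funB.
  exact: measurable_funM.
exact: (measurableT_comp (@measurable_sqnorm R n)).
Qed.

(** For fixed [eta] the shift [v = u + |eta|^2 / (2 r)] separates the variables: a Gamma integral in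
    [u] and a Gaussian [exp(-|eta|^2 / (2 r))] remain. *)
Lemma integral_laplace_profile n (r b : R) : 0 < r -> 0 <= b ->
  (\int[mu \x lebesgue_rvec R n]_z (laplace_profile r b (z.1, sqnorm z.2))%:E =
   ((2 * r) `^ b * Gamma (b + 1) * Num.sqrt (2 * pi * r) ^+ n)%:E)%E.
Proof.
move=> r0 b0; have r20 : 0 < 2 * r by rewrite mulr_gt0.
have mL := @measurable_laplace_profile r b n.
rewrite fubini_tonelli2; last 2 first.
- exact/measurable_EFinP.
- by move=> z; rewrite lee_fin laplace_profile_ge0.
pose c : R := (2 * r)^-1.
have c0 : 0 < c by rewrite invr_gt0.
transitivity (\int[lebesgue_rvec R n]_y
    (((2 * r) `^ b * Gamma (b + 1))%:E * (expR (- (c * sqnorm y)))%:E))%E.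
  apply: eq_integral => y _; rewrite /fubini_G/=.
  rewrite (@ge0_integral_affine _ 1 (c * sqnorm y)) ?oner_eq0//; last 2 first.
  - apply/measurable_EFinP; exact: (measurableT_comp mL (pair2_measurable y)).
  - by move=> x; rewrite lee_fin laplace_profile_ge0.
  rewrite normr1 mul1e.
  transitivity (\int[mu]_u (((2 * r) `^ b * expR (- (c * sqnorm y)))%:E *
      (pos_powR b u * expR (- u))%:E))%E.
    apply: eq_integral => u _; rewrite -EFinM mul1r /laplace_profile/= opprD expRD.
    rewrite (_ : 2 * r * (u + _) - _ = 2 * r * u); last first.
      by rewrite mulrDr mulrA divff ?gt_eqF// mul1r addrK.
    by rewrite pos_powRM//; congr EFin; ring.
  rewrite ge0_integralZl//.
  - by rewrite integral_pos_powR_expR// -!EFinM; congr EFin; ring.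
  - apply/measurable_EFinP; apply: measurable_funM; [exact: measurable_pos_powR|exact: measurableT_comp].
  - by move=> u _; rewrite lee_fin mulr_ge0 ?pos_powR_ge0 ?expR_ge0.
  - by rewrite lee_fin mulr_ge0 ?powR_ge0 ?expR_ge0.
rewrite ge0_integralZl//.
- rewrite integral_rvec_expR_sqnorm// -EFinM invrK; congr (_ * Num.sqrt _ ^+ _)%:E.
  by rewrite mulrA [pi * 2]mulrC.
- apply/measurable_EFinP/measurableT_comp => //; apply: measurableT_comp => //.
  by apply: measurable_funM => //; exact: measurable_sqnorm.
- rewrite lee_fin mulr_ge0 ?powR_ge0// -lee_fin -integral_pos_powR_expR//.
  by apply: integral_ge0 => t _; rewrite lee_fin mulr_ge0 ?pos_powR_ge0 ?expR_ge0.
Qed.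

End laplace_profile.

(** * The rescaled integrand: domination and pointwise limit *)

Section laplace_kernel.
Context {R : realType}.
Variables (a b A : R) (k : R -> R).
Hypothesis a0 : 0 < a.
Hypothesis b0 : 0 <= b.
Hypothesis k0 : forall w, a <= w -> k w = 0.
Hypothesis kA : k w / (a - w) `^ b @[w --> a^'-] --> A.

Let r := Num.sqrt a.
Let r0 : 0 < r. Proof. by rewrite sqrtr_gt0. Qed.
Let r2 : r ^+ 2 = a. Proof. by rewrite sqr_sqrtr// ltW. Qed.

Lemma continuous_powR (x : R) : 0 < x -> {for x, continuous (fun y : R => y `^ b)}.
Proof.
move=> x0; apply/differentiable_continuous/derivable1_diffP/derivable_powR.
by rewrite in_itv/= x0.
Qed.

Lemma pos_powR_le u v : u <= v -> pos_powR b u <= pos_powR b v.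
Proof.
move=> uv; rewrite {1}/pos_powR; case: ifPn => [u0|_]; last exact: pos_powR_ge0.
rewrite /pos_powR (lt_le_trans u0 uv) ge0_ler_powR// nnegrE ltW//.
exact: lt_le_trans uv.
Qed.

(** The limit [kA] with tolerance 1 gives the constant [|A| + 1] just below [a]; from [a] on both
    sides vanish. *)
Lemma near_edge_bound : exists r1, [/\ 0 < r1, r1 < r &
  forall w, r1 ^+ 2 < w -> `|k w| <= (`|A| + 1) * pos_powR b (a - w)].
Proof.
have [e /= e0 He] := cvgr_dist_lt _ _ kA _ ltr01.
(* The term [a - e] enters the neighbourhood where the limit is controlled; [a / 4] only keeps [m]
   positive when [e] is large. *)
pose m := Num.max (a - e) (a / 4).
have m0 : 0 < m by rewrite lt_max divr_gt0 ?orbT.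
have ma : m < a by rewrite gt_max ltrBlDr ltrDl e0 ltr_pdivrMr//= ltr_pMr// ltr1n.
exists (Num.sqrt m); rewrite sqrtr_gt0 m0 ltr_sqrt// ma; split=> // w.
rewrite sqr_sqrtr ?(ltW m0)// => mw.
have [aw|wa] := leP a w.
  by rewrite k0// normr0 mulr_ge0 ?pos_powR_ge0// addr_ge0.
have aw0 : 0 < a - w by rewrite subr_gt0.
have kw : `|A - k w / (a - w) `^ b| < 1.
  by apply: He => //=; rewrite gtr0_norm//; move: mw; rewrite gt_max ltrBlDr ltrBlDl addrC => /andP[].
have p0 : 0 < (a - w) `^ b by rewrite powR_gt0.
rewrite /pos_powR aw0 -ler_pdivrMr// -[in leLHS](gtr0_norm p0) -normf_div.
have -> : k w / (a - w) `^ b = A - (A - k w / (a - w) `^ b) by ring.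
apply: le_trans (ler_normB _ _) _; rewrite lerD2l; exact: ltW.
Qed.

(** Squared radius of the point with first coordinate [r - v/s] and transverse part [eta / sqrt s],
    where [t = |eta|^2]. *)
Definition laplace_point (s v t : R) : R := (r - v / s) ^+ 2 + t / s.

Lemma laplace_pointE s v t : s != 0 ->
  s * (a - laplace_point s v t) = 2 * r * v - t - v ^+ 2 / s.
Proof. by move=> s0; rewrite /laplace_point -r2; field. Qed.

Definition laplace_kernel (r1 s : R) (z : R * R) : R :=
  s `^ b * k (laplace_point s z.1 z.2) * expR (- z.1) * (r1 < r - z.1 / s)%R%:R.

(** On the cap [r1 < x] the squared radius exceeds [r1^2], so the edge bound applies. The factor
    [s^b] moves inside the power and produces [2 r v - t - v^2/s]; the last term has a favourable
    sign, and dropping it gives a bound free of [s]. *)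
Lemma laplace_kernel_le r1 s v t : 0 < r1 -> 0 < s -> 0 <= t ->
  (forall w, r1 ^+ 2 < w -> `|k w| <= (`|A| + 1) * pos_powR b (a - w)) ->
  `|laplace_kernel r1 s (v, t)| <= (`|A| + 1) * laplace_profile r b (v, t).
Proof.
move=> r10 s0 t0 Hk; rewrite /laplace_kernel/=.
case: ltP => h; last first.
  by rewrite mulr0 normr0 mulr_ge0 ?laplace_profile_ge0// addr_ge0.
rewrite mulr1 !normrM (gtr0_norm (expR_gt0 _)) (ger0_norm (powR_ge0 _ _)).
rewrite /laplace_profile mulrA ler_wpM2r ?expR_ge0//=.
apply: (@le_trans _ _ (s `^ b * ((`|A| + 1) * pos_powR b (a - laplace_point s v t)))).
  rewrite ler_wpM2l ?powR_ge0//; apply: Hk.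
  rewrite /laplace_point ltr_wpDr//; first by rewrite divr_ge0// ltW.
  by rewrite ltrXn2r// ltW// (lt_trans r10).
rewrite mulrCA -pos_powRM// laplace_pointE ?gt_eqF// ler_wpM2l ?addr_ge0//.
by apply: pos_powR_le; rewrite gerBl divr_ge0 ?sqr_ge0// ltW.
Qed.

Lemma cvg_laplace_point v t : laplace_point s v t @[s --> +oo] --> a.
Proof.
have iv : s^-1 @[s --> +oo] --> (0 : R).
  by apply/gtr0_cvgV0 => //; exists 0; split => // x.
have -> : a = (r - v * 0) ^+ 2 + t * 0 by rewrite !mulr0 subr0 addr0 r2.
apply: cvgD; last exact: cvgMr.
have h : r - v / s @[s --> +oo] --> r - v * 0.
  by apply: cvgB; [exact: cvg_cst|exact: cvgMr].
exact: (cvgM h h).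
Qed.

(** If [2 r v - t <= 0] the point lies outside the open ball for every [s > 0] and the kernel is
    exactly 0, as is the profile, including the boundary case with [b = 0]. Otherwise the point is
    eventually inside and [kA] can be composed with it. *)
Lemma cvg_laplace_kernel r1 v t : r1 < r ->
  laplace_kernel r1 s (v, t) @[s --> +oo] --> A * laplace_profile r b (v, t).
Proof.
move=> r1r.
have s_gt0 : \forall s \near +oo, 0 < s :> R by exists 0; split.
have iv : s^-1 @[s --> +oo] --> (0 : R) by apply/gtr0_cvgV0.
rewrite /laplace_profile/=; have [D0|D0] := leP (2 * r * v - t) 0.
  rewrite /pos_powR ltNge D0/= mul0r mulr0.
  apply: cvg_near_cst; near=> s.
  have s0 : 0 < s by near: s.
  rewrite /laplace_kernel k0 ?mulr0 ?mul0r//= -subr_le0.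
  rewrite -(pmulr_rle0 _ s0) laplace_pointE ?gt_eqF//.
  by rewrite subr_le0 (le_trans D0)// divr_ge0 ?sqr_ge0// ltW.
have sgap : 2 * r * v - t - v ^+ 2 / s @[s --> +oo] --> 2 * r * v - t.
  rewrite -[X in _ --> X]subr0 -(mulr0 (v ^+ 2)).
  by apply: cvgB; [exact: cvg_cst|exact: cvgMr].
have point_lt : \forall s \near +oo, laplace_point s v t < a.
  near=> s; have s0 : 0 < s by near: s.
  rewrite -subr_gt0 -(pmulr_rgt0 _ s0) laplace_pointE ?gt_eqF//.
  by near: s; exact: (cvgr_gt _ sgap).
(* [kA] is a limit along the punctured left filter at [a], so convergence to [a] must be paired with
   the strict inequality. *)
have point_left : laplace_point s v t @[s --> +oo] --> a^'-.
  move=> B [e /= e0 HB]; near=> s; apply: HB; last by near: s.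
  by near: s; exact: (cvgr_dist_lt _ _ (@cvg_laplace_point v t)).
have ind : (r1 < r - v / s)%R%:R @[s --> +oo] --> (1 : R).
  have rv : r - v / s @[s --> +oo] --> r.
    rewrite -[X in _ --> X]subr0 -(mulr0 v).
    by apply: cvgB; [exact: cvg_cst|exact: cvgMr].
  apply: cvg_near_cst; near=> s.
  suff -> : r1 < r - v / s by [].
  by near: s; exact: (cvgr_gt _ rv).
rewrite /pos_powR D0 mulrA -[X in _ --> X]mulr1.
apply: cvg_trans (cvgM (cvgM (cvgM (cvg_comp _ _ point_left kA)
  (cvg_comp _ _ sgap (continuous_powR D0))) (cvg_cst (expR (- v)))) ind).
apply: near_eq_cvg; near=> s => /=.
have s0 : 0 < s by near: s.
have pa : 0 < a - laplace_point s v t by rewrite subr_gt0; near: s.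
rewrite /laplace_kernel/=; congr (_ * _ * _).
rewrite -laplace_pointE ?gt_eqF// powRM ?ltW//.
by rewrite mulrCA divfK// gt_eqF// powR_gt0.
Unshelve. all: by end_near. Qed.

End laplace_kernel.

(** * Laplace asymptotics of the integral *)

Section laplace_integral.
Context {R : realType}.
Local Notation mu := (@lebesgue_measure R).
Local Notation RR := (measurableTypeR R).
Variables (n : nat) (a b A : R) (k : R -> R).
Hypothesis a0 : 0 < a.
Hypothesis b0 : 0 <= b.
Hypothesis mk : measurable_fun setT k.
Hypothesis k0 : forall w, a <= w -> k w = 0.
Hypothesis kA : k w / (a - w) `^ b @[w --> a^'-] --> A.

Let r := Num.sqrt a.
Let r0 : 0 < r. Proof. by rewrite sqrtr_gt0. Qed.
Let w (z : RR * rvec R n) : R := z.1 ^+ 2 + sqnorm z.2.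
Let mw : measurable_fun setT w. Proof. exact: measurable_sqradius. Qed.
Let nu := (mu \x lebesgue_rvec R n)%E.

Hypothesis ik : (\int[nu]_z `|(k (w z))%:E| < +oo)%E.

Let mkw : measurable_fun setT (fun z => k (w z)).
Proof. exact: (measurableT_comp mk mw). Qed.

Let mexp (s : R) : measurable_fun setT (fun z : RR * rvec R n => expR (s * z.1)).
Proof. by apply: (@measurableT_comp _ _ _ _ _ _ (@expR R)) => //; exact: measurable_funM. Qed.

Let x_lt_r z : k (w z) != 0 -> z.1 <= r.
Proof.
move=> kz; rewrite leNgt; apply/negP => rz; move/eqP: kz; apply; apply: k0.
rewrite -(sqr_sqrtr (ltW a0)) /w ler_wpDr ?sqnorm_ge0//.
by rewrite ltW// ltrXn2r// ltW.
Qed.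

Lemma integrable_radial : nu.-integrable setT (fun z => (k (w z))%:E).
Proof. by apply/integrableP; split => //; exact/measurable_EFinP. Qed.

(** On the support of [k] one has [x <= r], so under [P] the exponential is at most [exp(s c)]. The
    choice [c = r] serves integrability; [c = r1] with [P] the half-line below [r1] gives the
    exponential gain on the lower part. *)
Lemma integrable_radial_expR (s : R) (P : pred R) (c : R) :
  0 <= s -> measurable_fun setT (fun x : RR => P x) ->
  (forall x, P x -> x <= r -> x <= c) ->
  nu.-integrable setT (fun z => (k (w z) * expR (s * z.1) * (P z.1)%:R)%:E) /\
  (`|\int[nu]_z (k (w z) * expR (s * z.1) * (P z.1)%:R)%:E| <=
    (expR (s * c))%:E * \int[nu]_z `|(k (w z))%:E|)%E.
Proof.
move=> s0 mP Pc.
have mPz : measurable_fun setT (fun z : RR * rvec R n => (P z.1)%:R : R).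
  rewrite (_ : (fun z => _) = (fun z : RR * rvec R n => if P z.1 then 1 else 0)).
    by apply: measurable_fun_ifT => //; exact: (measurableT_comp mP measurable_fst).
  by apply/funext => z; case: (P _).
pose f z := k (w z) * expR (s * z.1) * (P z.1)%:R.
have mf : measurable_fun setT f by apply: measurable_funM => //; exact: measurable_funM.
have bound z : (`|(f z)%:E| <= (expR (s * c))%:E * `|(k (w z))%:E|)%E.
  rewrite /= -EFinM lee_fin /f !normrM (gtr0_norm (expR_gt0 _)).
  case: (boolP (P z.1)) => [Pz|_] /=; last first.
    by rewrite mulr0n normr0 mulr0 mulr_ge0 ?expR_ge0.
  rewrite normr1 mulr1 mulrC.
  have [->|kz] := eqVneq (k (w z)) 0; first by rewrite normr0 !mulr0.
  by rewrite ler_wpM2r// ler_expR ler_wpM2l// Pc// x_lt_r.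
have ib : nu.-integrable setT (fun z => (expR (s * c))%:E * `|(k (w z))%:E|)%E.
  by apply: integrableZl => //; exact: (integrable_abse integrable_radial).
have intf : nu.-integrable setT (EFin \o f).
  apply: le_integrable ib => //; first exact/measurable_EFinP.
  move=> z _; apply: le_trans (bound z) _.
  exact: lee_abs.
split => //; apply: le_trans (le_abse_integral _ _ _) _ => //.
  exact/measurable_EFinP.
rewrite -ge0_integralZl//; last first.
  by apply: measurableT_comp => //; exact/measurable_EFinP.
apply: ge0_le_integral => //.
- by apply: measurableT_comp => //; exact/measurable_EFinP.
- by case/integrableP: ib.
- by move=> z _; exact: bound.
Qed.

Let lower_part (r1 s : R) : \bar R :=
  (\int[nu]_z (k (w z) * expR (s * z.1) * (z.1 <= r1)%R%:R)%:E)%E.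
Let upper_part (r1 s : R) : \bar R :=
  (\int[nu]_z (k (w z) * expR (s * z.1) * (r1 < z.1)%R%:R)%:E)%E.

Let integral_split r1 s : 0 <= s ->
  (\int[nu]_z (k (w z) * expR (s * z.1))%:E = lower_part r1 s + upper_part r1 s)%E.
Proof.
move=> s0; rewrite /lower_part /upper_part -integralD//; last 2 first.
- have [] // := @integrable_radial_expR s (fun x => x <= r1) r s0.
  exact: measurable_fun_ler.
- have [] // := @integrable_radial_expR s (fun x => r1 < x) r s0.
  exact: measurable_fun_ltr.
apply: eq_integral => z _; rewrite -EFinD -mulrDr.
by case: leP => _; rewrite ?addr0 ?add0r mulr1.
Qed.

Let p : R := 1 + n%:R / 2 + b.

Let upper_partE r1 s : 0 < s ->
  ((s `^ p * expR (- (s * r)))%:E * upper_part r1 s =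
   \int[nu]_z (laplace_kernel a b k r1 s (z.1, sqnorm z.2))%:E)%E.
Proof.
move=> s0.
rewrite -integralZl//; last first.
  have [] // := @integrable_radial_expR s (fun x => r1 < x) r (ltW s0).
  exact: measurable_fun_ltr.
pose psi (z : RR * RR) : R := s `^ p * expR (- (s * r)) *
  (k (z.1 ^+ 2 + z.2) * expR (s * z.1) * (r1 < z.1)%R%:R).
have mpsi : measurable_fun setT psi.
  apply: measurable_funM => //; apply: measurable_funM; first apply: measurable_funM.
  - apply: (measurableT_comp mk); apply: measurable_funD => //; exact: measurable_funX.
  - by apply: (@measurableT_comp _ _ _ _ _ _ (@expR R)) => //; exact: measurable_funM.
  - rewrite (_ : (fun z => _) = (fun z : RR * RR => if r1 < z.1 then 1 else 0)).
      by apply: measurable_fun_ifT => //; exact: measurable_fun_ltr.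
    by apply/funext => z; case: (_ < _).
have s'0 : 0 < Num.sqrt s^-1 by rewrite sqrtr_gt0 invr_gt0.
transitivity (\int[nu]_z (psi (z.1, sqnorm z.2))%:E)%E.
  by apply: eq_integral => z _; rewrite -EFinM.
(* The Jacobian [s^(-1-n/2)] cancels all of [s^p] except [s^b], and [exp(-s r)] cancels all of
   [exp(s x)] except [exp(-v)]. *)
rewrite (@integral_scale _ n r s^-1 (Num.sqrt s^-1)) ?invr_gt0//.
apply: eq_integral => z _; congr EFin.
rewrite /psi/= /laplace_kernel/= /laplace_point -/r.
rewrite sqr_sqrtr ?invr_ge0 ?(ltW s0)// ![s^-1 * _]mulrC.
have -> : s * (r - z.1 / s) = s * r - z.1 by field; exact: lt0r_neq0.
rewrite expRD expRN.
have -> : s `^ p = s * Num.sqrt s ^+ n * s `^ b.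
  have sD u v : s `^ (u + v) = s `^ u * s `^ v.
    by rewrite powRD// (gt_eqF s0) implybT.
  rewrite /p !sD (powRr1 (ltW s0)); congr (_ * _ * _).
  by rewrite mulrC powRrM powR_mulrn ?powR_ge0// powR12_sqrt// ltW.
rewrite sqrtrV ?(ltW s0)// exprVn.
rewrite [expR (- (s * r))]expRN; field.
by rewrite !gt_eqF ?exprn_gt0 ?sqrtr_gt0 ?expR_gt0.
Qed.

Let upper_part_cvg r1 : 0 < r1 -> r1 < r ->
  (forall u, r1 ^+ 2 < u -> `|k u| <= (`|A| + 1) * pos_powR b (a - u)) ->
  s `^ p * expR (- (s * r)) * fine (upper_part r1 s) @[s --> +oo] -->
  A * ((2 * r) `^ b * Gamma (b + 1) * Num.sqrt (2 * pi * r) ^+ n).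
Proof.
move=> r10 r1r Hk.
pose K s (z : RR * rvec R n) := laplace_kernel a b k r1 s (z.1, sqnorm z.2).
pose L (z : RR * rvec R n) := laplace_profile r b (z.1, sqnorm z.2).
pose I := (2 * r) `^ b * Gamma (b + 1) * Num.sqrt (2 * pi * r) ^+ n.
have mL : measurable_fun setT L by exact: measurable_laplace_profile.
have iL : nu.-integrable setT (EFin \o L).
  apply/integrableP; split; first exact/measurable_EFinP.
  rewrite (eq_integral (EFin \o L)); last first.
    by move=> z _; rewrite gee0_abs// lee_fin laplace_profile_ge0.
  by rewrite integral_laplace_profile// ltry.
have mK s : measurable_fun setT (K s).
  rewrite /K /laplace_kernel/= -/r; apply: measurable_funM; last first.
    rewrite (_ : (fun z => _) =
        (fun z : RR * rvec R n => if r1 < r - z.1 / s then 1 else 0)); last first.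
      by apply/funext => z; case: (_ < _).
    apply: measurable_fun_ifT => //; apply: measurable_fun_ltr => //.
    by apply: measurable_funB => //; exact: measurable_funM.
  apply: measurable_funM; last first.
    by apply: (@measurableT_comp _ _ _ _ _ _ (@expR R)) => //; exact: measurable_funN.
  apply: measurable_funM => //; apply: (measurableT_comp mk).
  apply: measurable_funD.
    apply: measurable_funX; apply: measurable_funB => //; exact: measurable_funM.
  by apply: measurable_funM => //; exact: (measurableT_comp (@measurable_sqnorm R n)).
have K_le s z : 0 < s -> `|K s z| <= (`|A| + 1) * L z.
  by move=> s0; apply: laplace_kernel_le => //; exact: sqnorm_ge0.
(* Dominated convergence is sequential and asks for the bound at every index, whereas a sequence
   tending to infinity is only eventually positive; [Num.max s 1] repairs this without changing the
   limit. *)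
pose F s := fine (\int[nu]_z (K (Num.max s 1) z)%:E)%E.
have max0 s : 0 < Num.max s 1 :> R by rewrite lt_max ltr01 orbT.
have Fcvg : F s @[s --> +oo] --> A * I.
  apply/cvg_pinftyP => u uoo.
  have AI : (\int[nu]_z (A * L z)%:E = (A * I)%:E)%E.
    under eq_integral do rewrite EFinM.
    by rewrite integralZl// integral_laplace_profile.
  apply: fine_cvg; rewrite -AI.
  have maxoo : Num.max (u m) 1 @[m --> \oo] --> +oo.
    apply: ger_cvgy uoo; near=> m; by rewrite le_max lexx.
  have [] // := @dominated_convergence _ _ _ nu setT measurableT
    (fun m z => (K (Num.max (u m) 1) z)%:E) (fun z => (A * L z)%:E)
    (fun z => ((`|A| + 1)%:E * (L z)%:E)%E).
  - by move=> m; exact/measurable_EFinP.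
  - by apply/measurable_EFinP; exact: measurable_funM.
  - apply: aeW => z _; apply: cvg_EFin; first by near=> m.
    have := @cvg_laplace_kernel _ a b A k a0 k0 kA r1 z.1 (sqnorm z.2) r1r.
    by move/cvg_pinftyP; apply.
  - exact: integrableZl.
  - by apply: aeW => z m _; rewrite -EFinM /= lee_fin K_le.
apply: cvg_trans Fcvg; apply: near_eq_cvg; near=> s.
have s1 : 1 <= s by near: s; exact: nbhs_pinfty_ge.
have s0 : 0 < s by exact: lt_le_trans s1.
rewrite /F max_l// /K -upper_partE// fineM//.
have [] := @integrable_radial_expR s (fun x => r1 < x) r (ltW s0).
- exact: measurable_fun_ltr.
- by [].
- by move=> iU _; exact: integrable_fin_num.
Unshelve. all: by end_near. Qed.

(** With [t = s e], half of the exponential absorbs [t^q] and the other half still tends to 0. *)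
Let cvg_powR_expR (q e : R) : 0 <= q -> 0 < e ->
  s `^ q * expR (- (s * e)) @[s --> +oo] --> 0.
Proof.
move=> q0 e0; pose C := e `^ (- q) * (2 * (q + 1)) `^ q.
have lin : s * (e / 2) @[s --> +oo] --> +oo.
  apply/cvgryPge => M; near=> s; rewrite -ler_pdivrMr ?divr_gt0//.
have Ccvg : C * expR (- (s * (e / 2))) @[s --> +oo] --> 0.
  rewrite -(mulr0 C); apply: cvgMr.
  exact: (cvg_comp _ _ lin (@cvgr_expR R)).
apply: (squeeze_cvgr _ (cvg_cst 0) Ccvg); near=> s.
have s0 : 0 < s by near: s; exact: nbhs_pinfty_gt.
rewrite mulr_ge0 ?powR_ge0 ?expR_ge0//=.
have -> : s `^ q = e `^ (- q) * (s * e) `^ q.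
  rewrite powRM ?ltW// mulrCA powRN mulVf ?mulr1//.
  by rewrite gt_eqF// powR_gt0.
rewrite /C -!mulrA ler_wpM2l ?powR_ge0//.
apply: (@le_trans _ _ ((2 * (q + 1)) `^ q * expR (s * e / 2) * expR (- (s * e)))).
  by rewrite ler_wpM2r ?expR_ge0// powR_le_expR// mulr_ge0// ltW.
rewrite -mulrA -expRD (_ : s * e / 2 - s * e = - (s * (e / 2)))//; field.
Unshelve. all: by end_near. Qed.

Theorem cvg_laplace_integral :
  s `^ p * expR (- (s * r)) * fine (\int[nu]_z (k (w z) * expR (s * z.1))%:E)%E
    @[s --> +oo] -->
  A * ((2 * r) `^ b * Gamma (b + 1) * Num.sqrt (2 * pi * r) ^+ n).
Proof.
have [r1 [r10 r1r Hk]] := near_edge_bound a0 k0 kA.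
pose K0 := fine (\int[nu]_z `|(k (w z))%:E|)%E.
have p0 : 0 <= p by rewrite !addr_ge0// divr_ge0.
(* The lower part is at most [exp(s r1) K0] in absolute value, so the normalization leaves
   [s^p exp(-s (r - r1))]. *)
have lower0 : s `^ p * expR (- (s * r)) * fine (lower_part r1 s) @[s --> +oo] --> 0.
  have Kcvg : K0 * (s `^ p * expR (- (s * (r - r1)))) @[s --> +oo] --> 0.
    by rewrite -(mulr0 K0); apply: cvgMr; apply: cvg_powR_expR => //; rewrite subr_gt0.
  apply/norm_cvg0P; apply: (squeeze_cvgr _ (cvg_cst 0) Kcvg); near=> s.
  have s0 : 0 < s by near: s; exact: nbhs_pinfty_gt.
  rewrite normr_ge0/=.
  have [] := @integrable_radial_expR s (fun x => x <= r1) r1 (ltW s0).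
  - exact: measurable_fun_ler.
  - by [].
  move=> /(integrable_fin_num measurableT)/fineK lowerE.
  rewrite -/(lower_part r1 s) -[X in (`|X| <= _)%E]lowerE -/(lower_part r1 s).
  have K0E : (\int[nu]_z `|(k (w z))%:E| = K0%:E)%E.
    by rewrite fineK// ge0_fin_numE//; exact: integral_ge0.
  rewrite K0E -EFinM lee_fin => le_lower.
  rewrite !normrM (ger0_norm (powR_ge0 _ _)) (gtr0_norm (expR_gt0 _)).
  apply: le_trans (ler_wpM2l _ le_lower) _; first by rewrite mulr_ge0 ?powR_ge0 ?expR_ge0.
  rewrite mulrBr opprB expRD mulrA mulrC le_eqVlt; apply/orP; left; apply/eqP; ring.
have := cvgD lower0 (upper_part_cvg r10 r1r Hk); rewrite add0r => lim.
apply: cvg_trans (lim _); apply: near_eq_cvg; near=> s => /=.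
have s0 : 0 < s by near: s; exact: nbhs_pinfty_gt.
rewrite -mulrDr (integral_split r1 (ltW s0)) fineD//.
- have [] := @integrable_radial_expR s (fun x => x <= r1) r (ltW s0).
  + exact: measurable_fun_ler.
  + by [].
  + by move=> i _; exact: integrable_fin_num.
- have [] := @integrable_radial_expR s (fun x => r1 < x) r (ltW s0).
  + exact: measurable_fun_ltr.
  + by [].
  + by move=> i _; exact: integrable_fin_num.
Unshelve. all: by end_near. Qed.

End laplace_integral.

(** * Spheres are null sets *)

Section null_spheres.
Context {R : realType}.
Local Notation mu := (@lebesgue_measure R).
Local Notation RR := (measurableTypeR R).

(** By Tonelli, since each line parallel to the first axis meets the sphere in at most two points.
    The value [c = 0] covers the origin. *)
Lemma ae_sqradius_neq n (c : R) :
  {ae (mu \x lebesgue_rvec R n)%E, forall z, z.1 ^+ 2 + sqnorm z.2 != c}.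
Proof.
pose S := [set z : RR * rvec R n | z.1 ^+ 2 + sqnorm z.2 = c].
have mS : measurable S.
  rewrite -[S]setTI; apply: (@measurable_sqradius R n measurableT [set c]).
  exact: measurable_set1.
exists S; split => //; last first.
  by move=> z /= /negP; rewrite negbK => /eqP.
rewrite -[S]setIT -integral_indic// fubini_tonelli2; last 2 first.
- exact/measurable_EFinP.
- by move=> z; rewrite lee_fin.
rewrite integral0_eq// => y _; rewrite /fubini_G.
pose Sy : set RR := [set x | x ^+ 2 + sqnorm y = c].
have Sy0 : mu Sy = 0%E.
  apply: countable_lebesgue_measure0; pose d := Num.sqrt (c - sqnorm y).
  apply: (@sub_countable _ _ _ [set d; - d]); last exact/finite_set_countable/finite_set2.
  apply: subset_card_le => x /= xc.
  have := sqrtr_sqr x; rewrite -[x ^+ 2](addrK (sqnorm y)) xc -/d => dx.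
  have [x0|x0] := leP 0 x; [left|right]; rewrite dx.
    by rewrite ger0_norm.
  by rewrite ltr0_norm// opprK.
rewrite -[RHS]Sy0 -[Sy in RHS]setIT -integral_indic//.
have mq : measurable_fun setT (fun x : RR => x ^+ 2 + sqnorm y : RR).
  exact: measurable_funD.
by rewrite -[Sy]setTI; exact: (mq measurableT [set c] (measurable_set1 c)).
Qed.

End null_spheres.

Lemma cvg_sqrt_pinfty (R : realType) : Num.sqrt x @[x --> +oo] --> (+oo : set_system R).
Proof.
apply/cvgryPge => M; near=> x.
apply: le_trans (ler_norm M) _; rewrite -sqrtr_sqr ler_wsqrtr//.
Unshelve. all: by end_near. Qed.

(** * From [g] to an admissible radial weight *)

Section trimmed_weight.
Context {R : realType}.
Local Notation mu := (@lebesgue_measure R).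
Local Notation RR := (measurableTypeR R).
Variables (n : nat) (a b : R) (g : R -> R).
Hypothesis a0 : 0 < a.
Hypothesis b0 : 0 <= b.
Hypothesis mg : measurable_fun `[0, a] g.
Hypothesis glim : g w / (a - w) `^ b @[w --> a^'-] --> (1 : R).
Variable M : R.
Hypothesis gM : forall w, 0 <= w <= a -> w `^ (n%:R / 2) * `|g w| <= M.

(* The values at the radii 0 and sqrt a are replaced by 0: there (i) and (ii) do
   not give the bounds needed below, and the two spheres are null. *)
Definition trimmed_weight (w : R) : R :=
  if 0 < w < a then g w * radial_weight n.+1 w else 0.

Lemma measurable_g_indic : measurable_fun setT (fun w => g w * \1_(`[0, a]) w).
Proof.
rewrite (_ : (fun w => _) = g \_ `[0, a]%classic).
  by apply/(measurable_restrictT _ _).1.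
by apply/funext => w; rewrite patch_indic.
Qed.

Lemma measurable_trimmed_weight : measurable_fun setT trimmed_weight.
Proof.
(* [g] is measurable on [[0, a]] only; inserting the indicator makes the factor measurable on the
   whole line. *)
rewrite (_ : trimmed_weight = fun w =>
    if 0 < w < a then g w * \1_(`[0, a]) w * radial_weight n.+1 w else 0).
  apply: measurable_fun_ifT => //.
    apply: measurable_and; exact: measurable_fun_ltr.
  apply: measurable_funM; [exact: measurable_g_indic|exact: measurable_radial_weight].
apply/funext => w; rewrite /trimmed_weight; case: ifP => // /andP[w0 wa].
by rewrite indicE mem_set ?mulr1//= in_itv/= !ltW.
Qed.

Lemma trimmed_weight_ge w : a <= w -> trimmed_weight w = 0.
Proof. by move=> aw; rewrite /trimmed_weight andbC ltNge aw. Qed.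

Lemma trimmed_weight_cvg :
  trimmed_weight w / (a - w) `^ b @[w --> a^'-] --> radial_weight n.+1 a.
Proof.
have rwc : radial_weight n.+1 w @[w --> a^'-] --> radial_weight n.+1 a.
  apply: cvg_at_left_filter; apply: cvgMr.
  have h : - (w / 2) @[w --> a] --> - (a / 2) by apply: cvgN; exact: cvgMl.
  exact: (cvg_comp _ _ h (@continuous_expR R _)).
rewrite -[X in _ --> X]mul1r; apply: cvg_trans (cvgM glim rwc).
apply: near_eq_cvg; near=> w => /=; rewrite /trimmed_weight.
have -> : 0 < w < a.
  by apply/andP; split; near: w; [exact: nbhs_left_gt|exact: nbhs_left_lt].
by rewrite mulrAC.
Unshelve. all: by end_near. Qed.

Lemma integral_trimmed_weight_lty :
  (\int[mu \x lebesgue_rvec R n]_z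
    `|(trimmed_weight (z.1 ^+ 2 + sqnorm z.2))%:E| < +oo)%E.
Proof.
(* [radial_weight] decreases in the squared radius, so its value at 0 bounds it on []0, a]]. *)
apply: (@integral_radial_lty R n trimmed_weight a (M * radial_weight n.+1 0)) => //.
- exact: measurable_trimmed_weight.
- move=> w /andP[w0 wa]; rewrite /trimmed_weight w0/=.
  have M0 : 0 <= M by apply: le_trans (gM (w := w) _); rewrite ?mulr_ge0 ?powR_ge0// ltW.
  case: ifP => _; last by rewrite normr0 mulr0 mulr_ge0 ?radial_weight_ge0.
  rewrite normrM mulrA (ger0_norm (radial_weight_ge0 _ _)).
  apply: ler_pM; rewrite ?mulr_ge0 ?powR_ge0 ?radial_weight_ge0 ?gM ?wa ?(ltW w0)//.
  rewrite /radial_weight ler_wpM2l ?powR_ge0// ler_expR mul0r oppr0.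
  by rewrite oppr_le0 divr_ge0// ltW.
- move=> w; rewrite /trimmed_weight; case: ifP => // /andP[w0 wa].
  by rewrite w0 (ltW wa).
Qed.

Lemma expectation_trimmed d (T : measurableType d) (P : probability T R)
    (th : rvec R n.+1) (X : {RV P >-> rvec R n.+1}) : is_mvnormal X th ->
  ('E_P[(fun t => g (enorm (X t) ^+ 2) * \1_(`[0, a]) (enorm (X t) ^+ 2))%R] =
   \int[mu \x lebesgue_rvec R n]_z (trimmed_weight (z.1 ^+ 2 + sqnorm z.2) *
     expR (enorm th * z.1 - enorm th ^+ 2 / 2))%:E)%E.
Proof.
move=> XN; rewrite (expectation_mvnormal_radial XN measurable_g_indic).
have msq := @measurable_sqradius R n.
have mexp : measurable_fun setT
    (fun z : RR * rvec R n => expR (enorm th * z.1 - enorm th ^+ 2 / 2)).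
  apply: (@measurableT_comp _ _ _ _ _ _ (@expR R)) => //.
  by apply: measurable_funB => //; exact: measurable_funM.
apply: ae_eq_integral => //.
- apply/measurable_EFinP; apply: measurable_funM => //; apply: measurable_funM.
    exact: (measurableT_comp measurable_g_indic msq).
  exact: (measurableT_comp (measurable_radial_weight n.+1) msq).
- apply/measurable_EFinP; apply: measurable_funM => //.
  exact: (measurableT_comp measurable_trimmed_weight msq).
have aeF := @ae_filter_ringOfSetsType _ _ R (mu \x lebesgue_rvec R n)%E.
(* Off the null spheres of squared radius 0 and [a], the indicator of [[0, a]] agrees with the
   strict test [0 < w < a]. *)
apply: (@filterS2 _ _ aeF _ _ _ _ (ae_sqradius_neq n 0) (ae_sqradius_neq n a)) => z w0 wa _.
congr (_ * _)%:E; rewrite /trimmed_weight; set w := _ + _ in w0 wa *.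
have wge0 : 0 <= w by rewrite addr_ge0 ?sqr_ge0 ?sqnorm_ge0.
rewrite indicE mem_setE in_itv/= wge0 lt_neqAle eq_sym w0 wge0 lt_neqAle wa/=.
by case: (w <= a); rewrite ?mulr1// mulr0 mul0r.
Qed.

End trimmed_weight.

(** * The constant and the conclusion *)

Lemma sqrtr_exprn (R : realType) (x : R) n : 0 <= x -> Num.sqrt x ^+ n = x `^ (n%:R / 2).
Proof. by move=> x0; rewrite mulrC powRrM powR_mulrn ?powR_ge0// powR12_sqrt. Qed.

(** The transverse Gaussian contributes [(2 pi)^(n/2)] against [(2 pi)^(-(n+1)/2)] in the density,
    leaving [1 / sqrt (2 pi)]. The powers of [sqrt a] combine to [a^(n/4 + b/2)]. *)
Lemma limit_constE (R : realType) (a b : R) n : 0 < a ->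
  limit_const a b n.+1 = radial_weight n.+1 a *
    ((2 * Num.sqrt a) `^ b * Gamma (b + 1) * Num.sqrt (2 * pi * Num.sqrt a) ^+ n).
Proof.
move=> a0; have p2 : 0 < 2 * pi :> R by rewrite mulr_gt0// pi_gt0.
have s0 : 0 <= Num.sqrt a by exact: sqrtr_ge0.
rewrite /limit_const /radial_weight -natr1 addrK sqrtr_exprn; last exact: mulr_ge0 (ltW p2) s0.
rewrite (powRM _ (ltW p2) s0) (powRM _ _ s0)// -(powR12_sqrt (ltW a0)) -!powRrM.
rewrite -(powR12_sqrt (ltW p2)).
have -> : n%:R / 4 + b / 2 = 2^-1 * b + 2^-1 * (n%:R / 2) :> R by field.
have -> : - ((n%:R + 1) / 2) = - 2^-1 + - (n%:R / 2) :> R by field.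
have aD (x y : R) : a `^ (x + y) = a `^ x * a `^ y by rewrite powRD// (gt_eqF a0) implybT.
have pD (x y : R) : (2 * pi) `^ (x + y) = (2 * pi) `^ x * (2 * pi) `^ y.
  by rewrite powRD// (gt_eqF p2) implybT.
rewrite aD pD !powRN expRN; field.
by rewrite !gt_eqF ?expR_gt0 ?powR_gt0.
Qed.

Theorem theorem2p1 (R : realType) (p : nat) (hp : (2 <= p)%N)
    (a : R) (ha : 0 < a)
    (g : R -> R) (hg : measurable_fun `[0, a] g)
    (hbound : exists M : R, forall w : R, 0 <= w <= a ->
      w `^ ((p%:R - 1) / 2) * `|g w| <= M)
    (b : R) (hb : 0 <= b)
    (hlim : g w / (a - w) `^ b @[w --> a^'-] --> (1 : R)) :
  exists G : R -> R,
    (forall (d : measure_display) (T : measurableType d) (P : probability T R)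
        (theta : rvec R p) (X : {RV P >-> rvec R p}),
      is_mvnormal X theta ->
      ('E_P[(fun t => g (enorm (X t) ^+ 2) *
                      \1_(`[0, a]) (enorm (X t) ^+ 2))%R]
        = (G (enorm theta ^+ 2))%:E)%E) /\
    (nu `^ ((p%:R + 1) / 4 + b / 2) * expR (nu / 2)
       / expR (Num.sqrt nu * Num.sqrt a) * G nu
      @[nu --> +oo] --> limit_const a b p).
Proof.
case: p hp hbound => [//|n] hp [M hM].
have nE : n.+1%:R - 1 = n%:R :> R by rewrite -natr1 addrK.
have gM w : 0 <= w <= a -> w `^ (n%:R / 2) * `|g w| <= M by rewrite -nE; exact: hM.
set k := trimmed_weight n a g; set r := Num.sqrt a.
have r0 : 0 < r by rewrite sqrtr_gt0.
have mk : measurable_fun setT k := measurable_trimmed_weight n hg.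
have k0 w : a <= w -> k w = 0 := @trimmed_weight_ge R n a g w.
have klty := integral_trimmed_weight_lty ha hg gM.
pose V s : \bar R := (\int[lebesgue_measure \x lebesgue_rvec R n]_z
  (k (z.1 ^+ 2 + sqnorm z.2) * expR (s * z.1))%:E)%E.
have iV s : 0 <= s -> (lebesgue_measure \x lebesgue_rvec R n)%E.-integrable setT
    (fun z => (k (z.1 ^+ 2 + sqnorm z.2) * expR (s * z.1))%:E).
  move=> s0; have [] := @integrable_radial_expR R n a k ha mk k0 klty s xpredT r s0.
  - exact: measurable_cst.
  - by [].
  - by move=> + _; under eq_fun do rewrite mulr1.
(* The witness is built from Lebesgue integrals alone, so one function serves all probability spaces
   and all [theta]; finiteness of [V] on nonnegative [s] makes [fine] harmless. *)
exists (fun nu => fine (V (Num.sqrt nu)) * expR (- (nu / 2))); split.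
  move=> d T P th X XN; rewrite (expectation_trimmed hg XN).
  have s0 : 0 <= enorm th by exact: sqrtr_ge0.
  rewrite sqrtr_sqr ger0_norm// EFinM fineK; last exact: integrable_fin_num (iV _ s0).
  rewrite muleC -integralZl//; last exact: iV.
  by apply: eq_integral => z _; rewrite expRD -EFinM /k; congr EFin; ring.
have lim := cvg_laplace_integral ha hb mk k0 (@trimmed_weight_cvg R n a b g ha hlim) klty.
rewrite limit_constE//.
apply: cvg_trans (cvg_comp _ _ (@cvg_sqrt_pinfty R) lim).
apply: near_eq_cvg; near=> nu => /=.
have nu0 : 0 < nu by near: nu; exact: nbhs_pinfty_gt.
rewrite -/r -/(V (Num.sqrt nu)).
have -> : (n.+1%:R + 1) / 4 + b / 2 = 2^-1 * (1 + n%:R / 2 + b) :> R.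
  by rewrite -natr1; field.
rewrite powRrM powR12_sqrt ?(ltW nu0)// !expRN.
by field; rewrite !gt_eqF ?expR_gt0.
Unshelve. all: by end_near. Qed.
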